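(* Let $k\ge 3$ and $r\ge 1$ be integers. The $r\times r$ matrix $$K_{r} = \begin{pmatrix} \binom{k-2}{k-3} & \binom{k-1}{k-3} & \binom{k}{k-3} & \binom{k+1}{k-3} & \cdots & \binom{r+k-3}{k-3} \\ 1 & \binom{k-2}{k-3} & \binom{k-1}{k-3} & \binom{k}{k-3} & \cdots & \binom{r+k-4}{k-3} \\ 0 & 1 & \binom{k-2}{k-3} & \binom{k-1}{k-3} & \cdots & \binom{r+k-5}{k-3} \\ 0 & 0 & 1 & \binom{k-2}{k-3} & \cdots & \binom{r+k-6}{k-3} \\ \vdots & \vdots & \vdots & \vdots & \ddots & \vdots \\ 0 & 0 & 0 & 0 & \cdots & \binom{k-2}{k-3} \end{pmatrix}$$ (whose $(p,q)$ entry is $\binom{k-2+q-p}{k-3}$ if $q\ge p$, $1$ if $q=p-1$, and $0$ if $q<p-1$) is a production matrix for $k$-angulations of point sets in convex position; that is, $v^{i+1}=K_r v^{i}$ for all $i$ with $1\le i\le r-1$.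
   Context: A geometric graph on a finite point set $\mathcal S\subseteq\mathbb R^2$ has vertex set $\mathcal S$ and edges that are straight-line segments with endpoints in $\mathcal S$; it is plane if no two edges intersect except at common endpoints. A $k$-angulation is a 2-connected plane geometric graph in which every internal face is a $k$-gon. A $k$-angulation with exactly $i$ $k$-gons has $(k-2)i+2$ vertices, taken to be points $p_1,\dots,p_{(k-2)i+2}$ in convex position labelled in counter-clockwise order. Its root vertex is $p_{(k-2)i+2}$, and the degree of the root vertex is defined as the number of its incident edges minus $2$. For $1\le i\le r$, $v^i$ is the $r$-dimensional column vector whose $j$-th entry is the number of $k$-angulations with exactly $i$ $k$-gons whose root vertex has degree $j-1$ (so $v^1=(1,0,\dots,0)^\top$). A production matrix is a matrix satisfying $v^{i+1}=K_rv^i$. *)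

(* Defs.v *)
From mathcomp Require Import all_boot all_order all_algebra.
From mathcomp Require Import all_classical all_reals all_analysis.

Set Implicit Arguments.
Unset Strict Implicit.
Unset Printing Implicit Defensive.

Import Order.TTheory GRing.Theory Num.Theory.
Import numFieldNormedType.Exports.

Local Open Scope ring_scope.

(* Vertices are labels in 'I_n; an edge is the set of its two end labels. *)
Definition graph (n : nat) := {set {set 'I_n}}.

Definition loopless n (G : graph n) : bool := [forall e in G, #|e| == 2]%N.

Definition adj n (G : graph n) : rel 'I_n := fun u v => [set u; v]%SET \in G.

Definition k_connected (m n : nat) (G : graph n) : Prop :=
  (m < n)%N /\
  forall X : {set 'I_n}, (#|X| < m)%N ->
  forall x y : 'I_n, x \notin X -> y \notin X ->
    connect [rel u v | [&& adj G u v, u \notin X & v \notin X]] x y.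

(* The truncated subtraction is harmless on 2-connected graphs, all of whose
   vertices have at least two incident edges. *)
Definition root_degree n (G : graph n.+1) : nat :=
  (#|[set e in G | ord_max \in e]%SET| - 2)%N.

Local Open Scope classical_set_scope.

Section Plane.
Variable R : realType.

Definition plane := 'rV[R]_2.

Definition orient (a b c : plane) : R :=
  (b 0 0 - a 0 0) * (c 0 1 - a 0 1) - (b 0 1 - a 0 1) * (c 0 0 - a 0 0).

(* No point is a convex combination of the other ones. *)
Definition convex_position n (p : 'I_n -> plane) : Prop :=
  forall i, ~ exists w : 'I_n -> R,
    [/\ forall j, 0 <= w j, w i = 0, \sum_j w j = 1 &
        p i = \sum_j w j *: p j].

(* For points in convex position, the labels follow the boundary of the
   convex hull counter-clockwise iff all increasing triples turn left. *)
Definition ccw_labelled n (p : 'I_n -> plane) : Prop :=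
  forall i j l : 'I_n, (i < j)%N -> (j < l)%N -> 0 < orient (p i) (p j) (p l).

Definition segment (a b : plane) : set plane :=
  [set (1 - t) *: a + t *: b | t in `[0, 1]].

Section Drawing.
Variables (n : nat) (p : 'I_n -> plane).

Definition edge_drawing (e : {set 'I_n}) : set plane :=
  [set x | exists u v : 'I_n, e = [set u; v]%SET /\ segment (p u) (p v) x].

Definition plane_graph (G : graph n) : Prop :=
  forall e f : {set 'I_n}, e \in G -> f \in G -> e != f ->
  edge_drawing e `&` edge_drawing f `<=` [set p v | v in [set` (e :&: f)%SET]].

Definition drawing (G : graph n) : set plane :=
  \bigcup_(e in [set` G]) edge_drawing e.

Definition faces (G : graph n) : set (set plane) :=
  [set connected_component (~` drawing G) x | x in ~` drawing G].

Definition internal_faces (G : graph n) : set (set plane) :=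
  [set F | faces G F /\ bounded_set F].

(* The topological boundary of F is traced by a simple cycle of G with exactly
   k edges. *)
Definition kgon (k : nat) (G : graph n) (F : set plane) : Prop :=
  exists c : seq 'I_n,
    [/\ size c = k, uniq c, cycle (adj G) c &
        closure F `\` interior F =
        \bigcup_(u in [set` c]) segment (p u) (p (next c u))].

Definition kangulation (k : nat) (G : graph n) : Prop :=
  [/\ loopless G, plane_graph G, k_connected 2 G &
      forall F, internal_faces G F -> kgon k G F].

End Drawing.

(* Entry j (counted from 0) is the number of k-angulations of p with exactly i
   internal faces whose root, the last point, has degree j. *)
Definition degree_vector (k r i : nat) (p : 'I_((k - 2) * i).+2 -> plane) :
    'cV[nat]_r :=
  \col_(j < r) #|[pred G : graph ((k - 2) * i).+2 |
    `[< kangulation p k G /\ (internal_faces p G #= `I_i)%card >]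
    && (root_degree G == j)]|.

End Plane.

Definition production_matrix (r : nat) (K : 'M[nat]_r) (v : nat -> 'cV[nat]_r) :
    Prop :=
  forall i, (1 <= i <= r - 1)%N -> v i.+1 = K *m v i.

Definition Kmx (k r : nat) : 'M[nat]_r :=
  \matrix_(p < r, q < r)
    (if p <= q then 'C(k - 2 + (q - p), k - 3)
     else if p == q.+1 :> nat then 1 else 0)%N.

(* Main.v *)
(* Geometry. In convex position a 2-connected plane graph contains every hull
   edge: otherwise removing the last neighbour of one end of a missing hull edge
   separates the graph. The hull edges and the non-crossing chords then cut the
   hull into cells, one below each chord ab with b > a + 1, whose vertices are
   those of [a, b] seen from ab. An open cell is open and closed in the
   complement of the drawing, so the cells are exactly the bounded faces.

   Counting. Peel off the longest edge at the last vertex x: this trades one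
   k-gon for k - 2 more edges on the outer path from 0 to x and lowers the
     degree
   of x by one. Hence the k-angulations with i k-gons and root degree d are
   counted by the coefficient of z^(i-d-1) in C^((k-2)(d+1)), where
   C = 1 + z C^(k-1). With u = z C^(k-2) one has C = 1 / (1 - u), and expanding
   C^(k-2) in powers of u gives the rows of the matrix. *)
Require Import Defs.
From mathcomp Require Import all_boot all_order all_algebra.
From mathcomp Require Import all_classical all_reals all_analysis.
From mathcomp Require Import zify ring lra.

Set Implicit Arguments.
Unset Strict Implicit.
Unset Printing Implicit Defensive.

(** * Peeling dissections *)

Section Comb.
Import mathcomp.boot.fintype mathcomp.boot.finset.
Local Open Scope set_scope.
Local Open Scope nat_scope.

Variable n' : nat.
Let n := n'.+1.
Implicit Types (G H : graph n) (a b c d u v x y z : 'I_n).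

(** Peeling opens a [k]-gon, so what remains is no longer a [k]-angulation. [dissection k G x m] is
    a class stable under peeling: its edges lie in [[0, x]] and its outer path may have any number
    [m] of edges. The [k]-angulations are the case where [x] is the last label and [m = 1], the hull
    edge from [0] to [x] being the whole outer path. Peeling is reversible without recording the
    removed edge, because its left end is the [k]-th vertex of the new outer path counted back from
    [x]. As each peeled chord adds exactly [k - 2] outer edges, the numbers of labels and of outer
    edges determine the number of cells; having [i] faces is then automatic on [(k - 2) * i + 2]
    points. For the matrix, the coefficient of u^t in (1 - u)^-(k-2) is binom(k-3+t, k-3), and the
    factor u^t leads from degree p to degree q = p - 1 + t one step earlier. The ones below the
    diagonal are t = 0, and the entries with q >= p are t = q - p + 1. *)

Definition noncrossing G : Prop :=
  forall a b c d, a < c -> c < b -> b < d -> adj G a b -> adj G c d -> False.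

(** With edges read as arcs above the line of labels, this is the chain seen from above within
    [[a, b]]. The inequalities at [v] are strict: an edge never hides its own ends, and a unit edge
    hides nothing. *)
Definition uncovered G a b : {set 'I_n} :=
  [set v : 'I_n | (a <= v <= b) && ~~ [exists c : 'I_n, [exists d : 'I_n,
     [&& adj G c d, a <= c, c < v, v < d & d <= b]]]].

Lemma uncoveredP G a b v : reflect
  [/\ a <= v, v <= b &
   forall c d, adj G c d -> a <= c -> d <= b -> c < v -> v < d -> False]
  (v \in uncovered G a b).
Proof.
rewrite inE; apply: (iffP andP) => [[/andP[av vb] H]|[av vb H]]; split => //.
- move=> c d cd ac db cv vd; case/negP: H.
  by apply/existsP; exists c; apply/existsP; exists d; apply/and5P.
- by rewrite av vb.
- by apply/existsP => -[c /existsP[d /and5P[? ? ? ? ?]]]; exact: (H c d).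
Qed.

Lemma adjC G u v : adj G u v = adj G v u.
Proof. by rewrite /adj setUC. Qed.

Lemma edge_inj a b c d : a < b -> c < d -> [set a; b] = [set c; d] ->
  a = c /\ b = d.
Proof.
move=> ab cd E.
have /set2P a1 : a \in [set c; d] by rewrite -E set21.
have /set2P b1 : b \in [set c; d] by rewrite -E set22.
by case: a1 b1 ab cd => -> [] -> //; lia.
Qed.

Lemma adjD1 G a b c d : a < b -> c < d ->
  adj (G :\ [set a; b]) c d =
    adj G c d && ((c != a :> nat) || (d != b :> nat)).
Proof.
move=> ab cd; rewrite /adj in_setD1 andbC; congr andb.
rewrite !val_eqE -negb_and; congr negb.
apply/eqP/andP => [/edge_inj|[/eqP-> /eqP->]] //.
by move=> /(_ cd ab)[-> ->].
Qed.

Lemma adjU1 G a b c d : a < b -> c < d ->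
  adj ([set a; b] |: G) c d =
    adj G c d || ((c == a :> nat) && (d == b :> nat)).
Proof.
move=> ab cd; rewrite /adj in_setU1 orbC; congr orb.
rewrite !val_eqE.
apply/eqP/andP => [/edge_inj|[/eqP-> /eqP->]] //.
by move=> /(_ cd ab)[-> ->].
Qed.

Lemma noncrossing_sub G H : (forall a b, a < b -> adj H a b -> adj G a b) ->
  noncrossing G -> noncrossing H.
Proof.
move=> HG nc a b c d ac cb bd ab cd.
by apply: (nc a b c d) => //; apply: HG => //; lia.
Qed.

Lemma uncovered_ext G H a b :
  (forall c d, a <= c -> c.+1 < d -> d <= b -> adj G c d = adj H c d) ->
  uncovered G a b = uncovered H a b.
Proof.
move=> E; apply/setP => v; apply/uncoveredP/uncoveredP => -[av vb K];
  split => // c d.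
  by move=> cd ac db cv vd; apply: (K c d) => //; rewrite E //; lia.
by move=> cd ac db cv vd; apply: (K c d) => //; rewrite -E //; lia.
Qed.

Lemma uncovered_left G a b : a <= b -> a \in uncovered G a b.
Proof. by move=> ab; apply/uncoveredP; split => // c d; lia. Qed.

Lemma uncovered_right G a b : a <= b -> b \in uncovered G a b.
Proof. by move=> ab; apply/uncoveredP; split => // c d; lia. Qed.

(* m is the number of edges of the outer path, formed by the vertices of [0, x]
   that lie strictly below no edge. *)
Record dissection k G x m : Prop := Dissection {
  dissection_edge : forall e, e \in G ->
     exists a b, [/\ a < b, b <= x & e = [set a; b]];
  dissection_nc : noncrossing G;
  dissection_unit : forall a b, b = a.+1 :> nat -> b <= x -> adj G a b;
  dissection_cell : forall a b, adj G a b -> a.+1 < b ->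
     #|uncovered (G :\ [set a; b]) a b| = k;
  dissection_out : #|uncovered G ord0 x| = m.+1 }.

Definition deg G x := #|[set e in G | x \in e]|.

Lemma dissection_adj k G x m a b : dissection k G x m -> adj G a b -> a < b ->
  b <= x.
Proof.
by move=> C /(dissection_edge C)[c [d [cd dx E]]] ab;
  case: (edge_inj ab cd E) => _ ->.
Qed.

Lemma dissection_m_gt0 k G x m : dissection k G x m -> 0 < x -> 0 < m.
Proof.
move=> C x0; have := dissection_out C; case: m {C} => // /eqP/cards1P[v E].
have : (ord0 : 'I_n) \in uncovered G ord0 x by apply: uncovered_left.
have : x \in uncovered G ord0 x by apply: uncovered_right.
by rewrite E !inE => /eqP xv /eqP Z; move: x0; rewrite xv -Z.
Qed.

Lemma dissection_m_le k G x m : dissection k G x m -> m <= x.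
Proof.
move=> C; rewrite -ltnS -(dissection_out C).
have -> : x.+1 = #|[set v : 'I_n | v <= x]|.
  have W : x.+1 <= n by exact: ltn_ord.
  have inj : injective (widen_ord W) by move=> a b /(congr1 val)/= /val_inj.
  rewrite -[LHS]card_ord -(card_imset _ inj).
  apply: eq_card => v; rewrite inE; apply/imsetP/idP => [[w _ ->]|vx] /=.
    by have := ltn_ord w; rewrite ltnS.
  by exists (Ordinal (vx : v < x.+1)) => //; apply/val_inj.
by apply: subset_leq_card; apply/subsetP => v /uncoveredP[_ vx _]; rewrite inE.
Qed.

(** The only edge at [x] is a unit edge, which hides nothing: no cell changes, and the outer path
    just loses its last edge. *)
Lemma dissection_del_unit k G x y m : x = y.+1 :> nat -> dissection k G x m ->
  (forall z, adj G z x -> z < x -> z = y) ->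
  dissection k (G :\ [set y; x]) y m.-1.
Proof.
move=> xy C only; have yx : y < x by lia.
have D c d : c.+1 < d -> adj (G :\ [set y; x]) c d = adj G c d.
  by move=> cd; rewrite adjD1 //; lia.
split.
- move=> e /setD1P[ne eG]; have [a [b [ab bx E]]] := dissection_edge C eG.
  exists a, b; split => //; rewrite leqNgt; apply/negP => yb.
  have bE : b = x by apply/val_inj => /=; lia.
  case/eqP: ne; rewrite E bE; congr [set _; _]; apply: only;
    last by rewrite -bE.
  by rewrite /adj -bE -E.
- apply: noncrossing_sub (dissection_nc C) => a b ab.
  by rewrite adjD1 // => /andP[].
- move=> a b ab bx; rewrite adjD1 //; last lia.
  by rewrite (dissection_unit C) //; lia.
- move=> a b abG ab; rewrite D // in abG.
  rewrite -(dissection_cell C abG ab); congr #|pred_of_set _|.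
  by apply: uncovered_ext => c d ac cd db; rewrite !(@adjD1 _ a b) ?D //; lia.
- have xO : x \in uncovered G ord0 x by apply: uncovered_right.
  have := dissection_out C; rewrite (cardsD1 x) xO add1n => -[mE].
  have m0 : 0 < m by apply: dissection_m_gt0 C _; lia.
  rewrite prednK // -mE; congr #|pred_of_set _|; apply/setP => v.
  apply/uncoveredP/setD1P => [[_ vy K]|[/eqP vx /uncoveredP[_ vx' K]]].
    split; first by apply/eqP => vx; subst v; lia.
    apply/uncoveredP; split => //; first lia.
    move=> c d cd _ dx cv vd.
    have [dy|yd] := leqP d y; first by apply: (K c d) => //; rewrite D //; lia.
    have dE : d = x by apply/val_inj => /=; lia.
    have cx : c < x by lia.
    by rewrite dE in cd; have := only c cd cx => cE; subst c; lia.
  split => //; first by have : v <> x :> nat; [move/val_inj|lia].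
  move=> c d; have [cd|cd] := ltnP c.+1 d; last lia.
  by rewrite D // => cdG _ dy; apply: K => //; lia.
Qed.

Lemma dissection_add_unit k G x y m : x = y.+1 :> nat -> dissection k G y m ->
  [/\ dissection k ([set y; x] |: G) x m.+1, [set y; x] \notin G
   & forall z, adj ([set y; x] |: G) z x -> z < x -> z = y].
Proof.
move=> xy C; have yx : y < x by lia.
have yxG : [set y; x] \notin G.
  by apply/negP => /(dissection_adj C)/(_ yx); lia.
have D c d : c.+1 < d -> adj ([set y; x] |: G) c d = adj G c d.
  by move=> cd; rewrite adjU1 //; lia.
split => //; last first.
  move=> z + zx; rewrite adjU1 // => /orP[|/andP[/eqP/val_inj-> //]].
  by move=> /(dissection_adj C)/(_ zx); lia.
split.
- move=> e /setU1P[->|eG]; first by exists y, x.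
  have [a [b [ab bx E]]] := dissection_edge C eG.
  by exists a, b; split => //; lia.
- move=> a b c d ac cb bd.
  rewrite !adjU1 //; try lia.
  move=> /orP[abG|/andP[/eqP ay /eqP bx]] /orP[cdG|/andP[/eqP cy /eqP dx]].
  + exact: dissection_nc C _ _ _ _ ac cb bd abG cdG.
  + by have := dissection_adj C abG; lia.
  + by lia.
  + by lia.
- move=> a b ab bx; rewrite adjU1; try lia.
  have [by'|yb] := leqP b y; first by rewrite (dissection_unit C).
  by apply/orP; right; apply/andP; split; apply/eqP; lia.
- move=> a b abG ab; rewrite D // in abG.
  rewrite -(dissection_cell C abG ab); congr #|pred_of_set _|.
  by apply: uncovered_ext => c d ac cd db; rewrite !(@adjD1 _ a b) ?D //; lia.
- have xO : x \notin uncovered G ord0 y by apply/negP => /uncoveredP[]; lia.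
  transitivity #|x |: uncovered G ord0 y|; last by rewrite cardsU1 xO
    (dissection_out C).
  congr #|pred_of_set _|; apply/setP => v.
  apply/uncoveredP/setU1P => [[_ vx K]|[->|/uncoveredP[_ vy K]]].
  + have [vy|yv] := leqP v y; last by left; apply/val_inj => /=; lia.
    right; apply/uncoveredP; split => // c d cd _ dy cv vd.
    by apply: (K c d) => //; rewrite ?D //; lia.
  + by split => // c d; lia.
  + split => //; first lia.
    move=> c d; have [cd|cd] := ltnP c.+1 d; last lia.
    rewrite D // => cdG _ dx; apply: K => //.
    by apply: dissection_adj C cdG _; lia.
Qed.

(** No edge that starts left of [z] hides a vertex of [[z, x]]: if it ends before [x] it would cross
    [zx], and if it ends at [x] it would be longer than [zx]. Removing [zx] therefore glues its cell
    to the old outer path along [z] and [x] only. *)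
Lemma uncovered_del_longest G x z : noncrossing G -> adj G z x -> z < x ->
  (forall a b, adj G a b -> a < b -> b <= x) ->
  (forall z', adj G z' x -> z' < x -> z <= z') ->
  uncovered (G :\ [set z; x]) ord0 x
    = uncovered G ord0 x :|: uncovered (G :\ [set z; x]) z x /\
  uncovered G ord0 x :&: uncovered (G :\ [set z; x]) z x = [set z; x].
Proof.
move=> nc zxG zx lex zmin.
have cz c d v : adj G c d -> z <= v -> v <= x -> c < v -> v < d -> c < z ->
  False.
  move=> cdG zv vx cv vd cz.
  have dx : d <= x by apply: lex cdG _; lia.
  have [dx'|xd] := ltnP d x; first by apply: (nc c d z x) => //; lia.
  have dE : d = x by apply/val_inj => /=; lia.
  by subst d; have := zmin _ cdG; lia.
split; apply/setP => v.
  apply/uncoveredP/setUP => [[_ vx K]|[/uncoveredP[_ vx K]|/uncoveredP[zv vx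
    K]]].
  - have [zv|vz] := leqP z v.
      right; apply/uncoveredP; split => // c d cdG zc; exact: K.
    left; apply/uncoveredP; split => // c d cdG _ dx cv vd;
      apply: (K c d) => //.
    by rewrite adjD1 ?cdG //=; lia.
  - split => // c d cdG _ dx cv vd; apply: (K c d) => //.
    by move: cdG; rewrite adjD1 => [/andP[]||]; lia.
  - split => // c d cdG _ dx cv vd.
    have [zc|] := leqP z c; first exact: (K c d).
    apply: (cz c d v) => //.
    by move: cdG; rewrite adjD1 => [/andP[]||]; lia.
apply/setIP/set2P => [[/uncoveredP[_ vx K] /uncoveredP[zv _ _]]|[]->].
- have [zv'|zv'] := ltnP z v; last by left; apply/val_inj => /=; lia.
  have [vx'|vx'] := ltnP v x; last by right; apply/val_inj => /=; lia.
  by case: (K z x).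
- split; last by apply: uncovered_left; lia.
  apply/uncoveredP; split => //; first lia.
  by move=> c d cdG _ dx cv vd; apply: (cz c d z) => //; lia.
- by split; apply: uncovered_right => //; lia.
Qed.

(** The last two conclusions locate [z] on the new outer path by counting alone, which makes the
    removal injective. *)
Lemma dissection_del_long k G x z m : 2 < k -> dissection k G x m -> z.+1 < x ->
  adj G z x -> (forall z', adj G z' x -> z' < x -> z <= z') ->
  [/\ dissection k (G :\ [set z; x]) x (m + (k - 2)),
    z \in uncovered (G :\ [set z; x]) ord0 x &
    #|[set v in uncovered (G :\ [set z; x]) ord0 x | z <= v]| = k].
Proof.
move=> k2 C zx zxG zmin; have zx' : z < x by lia.
have [EU EI] := uncovered_del_longest (dissection_nc C) zxG zx' (fun a b =>
  dissection_adj C) zmin.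
have ck := dissection_cell C zxG zx.
split; last 2 first.
- by rewrite EU inE [X in _ || X]uncovered_left ?orbT //; lia.
- rewrite -ck; congr #|pred_of_set _|; apply/setP => v; rewrite [LHS]inE.
  apply/andP/idP => [[/uncoveredP[_ vx K] zv]|vU].
    by apply/uncoveredP; split => // c d cdG zc dx; apply: K => //.
  by split; [rewrite EU inE vU orbT|case/uncoveredP: vU].
split.
- by move=> e /setD1P[_ /(dissection_edge C)].
- apply: noncrossing_sub (dissection_nc C) => a b ab.
  by rewrite adjD1 // => /andP[].
- move=> a b ab bx; rewrite adjD1 //; last lia.
  by rewrite (dissection_unit C) //; lia.
- move=> a b abG ab; move: abG; rewrite adjD1 //; last lia.
  move=> /andP[abG ne]; rewrite -(dissection_cell C abG ab);
    congr #|pred_of_set _|.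
  apply: uncovered_ext => c d ac cd db; rewrite !(@adjD1 _ a b) ?(@adjD1 _ z x)
    //; try lia.
  have bx := dissection_adj C abG (ltnW ab).
  have [/andP[cz dx]|] := boolP ((c == z :> nat) && (d == x :> nat));
    last by lia.
  have bE : b = x by apply/val_inj => /=; lia.
  have := zmin a; rewrite -bE abG; lia.
(* The shared vertices [z] and [x] are counted once: [(m + 1) + k - 2] outer vertices. *)
- have := cardsUI (uncovered G ord0 x) (uncovered (G :\ [set z; x]) z x).
  rewrite -EU EI cards2 (dissection_out C) ck.
  by have -> : (z != x) = true; [rewrite -val_eqE /=; lia|lia].
Qed.

Lemma card_upper (A : {set 'I_n}) t : 0 < t <= #|A| ->
  exists2 z, z \in A & #|[set v in A | z <= v]| = t.
Proof.
have [s] := ubnP #|A|; elim: s A => // s IH A As /andP[t0 tA].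
have /card_gt0P[a0 a0A] : 0 < #|A| by lia.
case: (arg_minnP (fun i : 'I_n => nat_of_ord i) a0A) => z;
  rewrite -/(z \in A) => zA zmin.
have [tE|tA'] := eqVneq t #|A|.
  exists z => //; rewrite tE; congr #|pred_of_set _|; apply/setP => v.
  by rewrite inE andb_idr // => /zmin.
have cA : #|A| = #|A :\ z|.+1 by rewrite (cardsD1 z A) zA.
have [||w] := IH (A :\ z); try by move/eqP: tA'; lia.
rewrite inE => /andP[wz wA] <-; exists w => //.
congr #|pred_of_set _|; apply/setP => v; rewrite !inE.
have [->|//] := eqVneq v z; rewrite zA /=.
apply/negbTE; rewrite -ltnNge.
have := zmin _ wA; rewrite leq_eqVlt => /orP[|//].
by rewrite val_eqE eq_sym; rewrite inE in wz; rewrite (negbTE wz).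
Qed.

Lemma card_upper_inj (A : {set 'I_n}) z z' : z \in A -> z' \in A ->
  #|[set v in A | z <= v]| = #|[set v in A | z' <= v]| -> z = z'.
Proof.
wlog zz' : z z' / z < z' => [W zA z'A E|zA z'A E].
  case: (ltngtP z z') => [h|h|/val_inj//]; first exact: W.
  by apply/esym/W.
suff P : [set v in A | z' <= v] \proper [set v in A | z <= v].
  by have := proper_card P; rewrite E ltnn.
apply/properP; split.
  by apply/subsetP => v; rewrite !inE => /andP[-> ]; lia.
by exists z; rewrite !inE zA //= -ltnNge.
Qed.

(** The new chord must close a [k]-gon with the end of the outer path, which forces [z] to be the
    [k]-th outer vertex from the right. It exists because the path has [m + k - 1 >= k] vertices. *)
Lemma dissection_add_long k G x m : 2 < k -> 0 < m ->
  dissection k G x (m + (k - 2)) ->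
  exists z, [/\ z.+1 < x, [set z; x] \notin G, dissection k ([set z;
    x] |: G) x m,
    (forall z', adj ([set z; x] |: G) z' x -> z' < x -> z <= z') &
    z \in uncovered G ord0 x /\ #|[set v in uncovered G ord0 x | z <= v]| = k].
Proof.
move=> k2 m0 C.
have [|z zO zk] := @card_upper (uncovered G ord0 x) k;
  first by rewrite (dissection_out C); lia.
have zx : z <= x by case/uncoveredP: zO.
(* As [k > 2], an outer vertex [v] lies strictly between [z] and [x]. Any edge from [x] to a label
   at or before [z] would hide it, so [zx] is new and becomes the longest edge at [x]. *)
have [v [vO zv vx]] : exists v, [/\ v \in uncovered G ord0 x, z < v & v < x].
  have : ~~ ([set v in uncovered G ord0 x | z <= v] \subset [set z; x]).
    apply/negP => /subset_leq_card; rewrite zk cards2; case: (z != x); lia.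
  case/subsetPn => v; rewrite !inE -!val_eqE /= negb_or =>
    /andP[vO zv] /andP[vz vx].
  have : v <= x by case/andP: vO.
  by exists v; split; [rewrite inE|lia|lia].
have zmin z' : adj G z' x -> z' < x -> z < z'.
  move=> z'x z'x'; rewrite ltnNge; apply/negP => z'z.
  by case/uncoveredP: vO => _ _ /(_ z' x z'x); apply => //; lia.
have zxG : [set z; x] \notin G by apply/negP => /zmin; lia.
have zx1 : z.+1 < x by lia.
have zx2 : z < x by lia.
have Gd : ([set z; x] |: G) :\ [set z; x] = G by apply: setU1K.
have lex a b : adj ([set z; x] |: G) a b -> a < b -> b <= x.
  move=> + ab; rewrite adjU1 // => /orP[/(dissection_adj C)->//|]; lia.
have zmin' z' : adj ([set z; x] |: G) z' x -> z' < x -> z <= z'.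
  move=> + z'x; rewrite adjU1 // => /orP[/zmin|]; lia.
have nc : noncrossing ([set z; x] |: G).
  have K c d : adj G c d -> c < z -> z < d -> False.
    move=> cdG cz zd; case/uncoveredP: zO => _ _ /(_ c d cdG); apply => //.
    by apply: dissection_adj C cdG _; lia.
  move=> a b c d ac cb bd.
  rewrite !adjU1 //; try lia.
  move=> /orP[abG|/andP[/eqP ay /eqP bx]] /orP[cdG|/andP[/eqP cy /eqP dx]].
  + exact: dissection_nc C _ _ _ _ ac cb bd abG cdG.
  + by apply: (K a b) => //; lia.
  + by have := dissection_adj C cdG; lia.
  + by lia.
have zxU : adj ([set z; x] |: G) z x by rewrite adjU1 // !eqxx orbT.
have [EU EI] := uncovered_del_longest nc zxU zx2 lex zmin'.
rewrite Gd in EU EI.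
have ck : #|uncovered G z x| = k.
  rewrite -zk; congr #|pred_of_set _|; apply/setP => w; rewrite [RHS]inE.
  apply/idP/andP => [wO|[/uncoveredP[_ wx K] zw]]; last first.
    by apply/uncoveredP; split => // c d cdG zc dx; apply: K => //.
  by split; [rewrite EU inE wO orbT|case/uncoveredP: wO].
exists z; split => //; split => //.
- move=> e /setU1P[->|/(dissection_edge C)//]; first by exists z, x.
- by move=> a b ab bx; rewrite adjU1 ?(dissection_unit C) //; lia.
- move=> a b abG ab; move: abG; rewrite adjU1 //; last lia.
  case/orP => [abG|/andP[/eqP/val_inj-> /eqP/val_inj->]]; last by rewrite Gd.
  rewrite -(dissection_cell C abG ab); congr #|pred_of_set _|.
  apply: uncovered_ext => c d ac cd db; rewrite !(@adjD1 _ a b) ?(@adjU1 _ z x)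
    //; try lia.
  have bx := dissection_adj C abG (ltnW ab).
  have [/andP[cz dx]|] := boolP ((c == z :> nat) && (d == x :> nat));
    last by lia.
  have bE : b = x by apply/val_inj => /=; lia.
  by have := zmin a; rewrite -bE abG; lia.
- have := cardsUI (uncovered ([set z; x] |: G) ord0 x) (uncovered G z x).
  rewrite -EU EI cards2 (dissection_out C) ck.
  have -> : (z != x) = true; [rewrite -val_eqE /=; lia|move=> E].
  by apply: (@addIn k); rewrite -E /=; lia.
Qed.

(** * Bijections by peeling, and the resulting counts *)

Lemma deg_del G z x : [set z; x] \in G -> deg G x = (deg (G :\ [set z;
  x]) x).+1.
Proof.
move=> zxG; rewrite /deg (cardsD1 [set z; x]) inE zxG set22 /= add1n.
congr (#|pred_of_set _|).+1; apply/setP => e; rewrite !inE.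
by rewrite andbA.
Qed.

Lemma deg1P k G x y m : x = y.+1 :> nat -> dissection k G x m ->
  reflect (forall z, adj G z x -> z < x -> z = y) (deg G x == 1).
Proof.
move=> xy C; have yxG : [set y; x] \in G by apply: (dissection_unit C) => //;
  lia.
apply: (iffP cards1P) => [[e E] z zx zltx|only].
  have /set1P ey : [set y; x] \in [set e] by rewrite -E inE yxG set22.
  have /set1P ez : [set z; x] \in [set e] by rewrite -E inE set22 andbT.
  by case: (@edge_inj z x y x) => //; [lia|rewrite ey].
exists [set y; x]; apply/setP => e; rewrite !inE.
apply/andP/eqP => [[eG xe]|->]; last by rewrite yxG set22.
have [a [b [ab bx E]]] := dissection_edge C eG.
have bE : b = x.
  by move: xe; rewrite E => /set2P[xa|//]; move: ab; rewrite -xa; lia.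
by rewrite E bE; congr [set _; _]; apply: only; rewrite -?bE // /adj -E.
Qed.

(** Bijections are given as relations, since the peeled edge is only known through existence
    statements. *)
Lemma card_rel (T U : finType) (A : {set T}) (B : {set U}) (r : T -> U ->
  Prop) :
  (forall s, s \in A -> exists2 t, t \in B & r s t) ->
  (forall t, t \in B -> exists2 s, s \in A & r s t) ->
  (forall s t t', s \in A -> r s t -> r s t' -> t = t') ->
  (forall s s' t, s \in A -> s' \in A -> r s t -> r s' t -> s = s') ->
  #|A| = #|B|.
Proof.
move=> tA tB fr ir; apply/eqP; rewrite eqn_leq; apply/andP; split.
  have [->|[s0 s0A]] := set_0Vmem A; first by rewrite cards0.
  have [t0 _ _] := tA _ s0A.
  have f s : {t : U | s \in A -> t \in B /\ r s t}.
    apply: cid; have [/tA[t]|] := boolP (s \in A); first by exists t.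
    by exists t0.
  rewrite -(@card_in_imset _ _ (fun s => sval (f s))) => [|s s' sA s'A].
    apply/subset_leq_card/subsetP => _ /imsetP[s sA ->].
    by case: (svalP (f s) sA).
  case: (f s) => t /= /(_ sA)[_ rst]; case: (f s') => t' /= /(_ s'A)[_ + tt'].
  by rewrite -tt'; apply: ir rst.
have [->|[t0 t0B]] := set_0Vmem B; first by rewrite cards0.
have [s0 _ _] := tB _ t0B.
have f t : {s : T | t \in B -> s \in A /\ r s t}.
  apply: cid; have [/tB[s]|] := boolP (t \in B); first by exists s.
  by exists s0.
rewrite -(@card_in_imset _ _ (fun t => sval (f t))) => [|t t' tB' t'B].
  apply/subset_leq_card/subsetP => _ /imsetP[t tB' ->].
  by case: (svalP (f t) tB').
case: (f t) => s /= /(_ tB')[sA rst]; case: (f t') => s' /= /(_ t'B)[_ + ss'].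
by rewrite -ss'; apply: fr rst.
Qed.

Definition dissections k x m : {set graph n} :=
  [set G | `[< dissection k G x m >]].

Lemma card_deg1 k x y m : x = y.+1 :> nat ->
  #|[set G in dissections k x m.+1 | deg G x == 1]| = #|dissections k y m|.
Proof.
move=> xy.
apply: (card_rel (r := fun G H => [set y; x] \in G /\ H = G :\ [set y; x])).
- move=> G; rewrite !inE => /andP[/asboolP C /(deg1P xy C) only].
  exists (G :\ [set y; x]); first by rewrite inE;
    apply/asboolP/(dissection_del_unit xy C).
  by split => //; apply: (dissection_unit C) => //; lia.
- move=> H; rewrite !inE => /asboolP /(dissection_add_unit xy)[C nH only].
  exists ([set y; x] |: H); last by rewrite setU1K ?setU11.
  by rewrite !inE; apply/andP; split; [apply/asboolP|apply/(deg1P xy C)].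
- by move=> G H H' _ [_ ->] [_ ->].
- by move=> G G' H _ _ [yG HE] [yG' HE']; rewrite -(setD1K yG) -HE HE' setD1K.
Qed.

(** [D] is left free so that one bijection serves both the total count and the count by degree. *)
Lemma card_deg_gt1 k x m (D : pred nat) : 2 < k -> 0 < m ->
  #|[set G in dissections k x m | (1 < deg G x) && D (deg G x).-1]| =
  #|[set G in dissections k x (m + (k - 2)) | D (deg G x)]|.
Proof.
move=> k2 m0.
apply: (card_rel (r := fun G H => exists z,
  [/\ z.+1 < x, adj G z x, forall z', adj G z' x -> z' < x -> z <= z'
    & H = G :\ [set z; x]])).
- move=> G; rewrite !inE => /and3P[/asboolP C d1 dD].
  have x0 : 0 < x.
    rewrite lt0n; apply/eqP => x0.
    have : 0 < deg G x by lia.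
    case/card_gt0P => e; rewrite inE => /andP[eG xe].
    have [a [b [ab bx E]]] := dissection_edge C eG; lia.
  have yn : x.-1 < n by have := ltn_ord x; lia.
  pose y := Ordinal yn; have xy : x = y.+1 :> nat by rewrite /= prednK.
  have [z0 z0x z0G] : exists2 z0 : 'I_n, z0.+1 < x & adj G z0 x.
    apply: contrapT => nz.
    have /(deg1P xy C)/eqP : forall z, adj G z x -> z < x -> z = y; last by lia.
    move=> z zxG zx; apply/val_inj => /=; apply: contrapT => zy; apply: nz.
    by exists z => //; lia.
  case: (@arg_minnP _ z0 (fun z => adj G z x && (z < x)) (@nat_of_ord n)).
    by rewrite z0G; lia.
  move=> z /andP[zG zx] zmin.
  have zmin' z' : adj G z' x -> z' < x -> z <= z'.
    by move=> z'G z'x; apply: zmin; rewrite z'G.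
  have zx1 : z.+1 < x by have := zmin' _ z0G; lia.
  have [C' _ _] := dissection_del_long k2 C zx1 zG zmin'.
  exists (G :\ [set z; x]); last by exists z.
  rewrite !inE; apply/andP; split; first exact/asboolP.
  by move: dD; rewrite (deg_del zG).
- move=> H; rewrite !inE => /andP[/asboolP C dD].
  have [z [zx nH C' zmin _]] := dissection_add_long k2 m0 C.
  have zG : adj ([set z; x] |: H) z x by rewrite /adj setU11.
  have HE : ([set z; x] |: H) :\ [set z; x] = H by rewrite setU1K.
  exists ([set z; x] |: H); last by exists z.
  rewrite !inE (deg_del zG) HE /= dD andbT; apply/andP; split;
    first exact/asboolP.
  rewrite ltnS; apply/card_gt0P.
  have yn : x.-1 < n by have := ltn_ord x; lia.
  exists [set Ordinal yn; x]; rewrite inE set22 andbT.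
  by apply: (dissection_unit C) => //=; lia.
- move=> G H H' _ [z [zx zG zmin ->]] [z' [zx' zG' zmin' ->]].
  suff -> : z = z' by [].
  apply/val_inj/eqP; rewrite /= eqn_leq zmin ?zmin' //; lia.
- move=> G G' H; rewrite !inE => /and3P[/asboolP C _ _] /and3P[/asboolP C' _ _].
  move=> [z [zx zG zmin HE]] [z' [zx' zG' zmin' HE']].
  have [_ zU zk] := dissection_del_long k2 C zx zG zmin.
  have [_ zU' zk'] := dissection_del_long k2 C' zx' zG' zmin'.
  rewrite -HE in zU zk; rewrite -HE' in zU' zk'.
  have zz' : z = z' by apply: card_upper_inj zU zU' _; rewrite zk zk'.
  by rewrite -(setD1K zG) -HE HE' zz' setD1K.
Qed.

(* The coefficient of z^j in C^m, where C = 1 + z C^(k-1). *)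
Fixpoint forest_count k j : nat -> nat :=
  if j is j'.+1 then
    fix N m := if m is m'.+1 then N m' + forest_count k j' (m' + k.-1) else 0
  else fun=> 1.

(** The summands are the cases of one edge and of several edges at [x]; they mirror C^(m+1) = C^m +
    z C^(m+k-1). *)
Lemma card_dissectionsS k x y m : 2 < k -> x = y.+1 :> nat ->
  #|dissections k x m.+1| = #|dissections k y m| + #|dissections k x (m +
    k.-1)|.
Proof.
move=> k2 xy; rewrite -(card_deg1 k m xy).
have -> : m + k.-1 = m.+1 + (k - 2) by lia.
have := card_deg_gt1 x (fun=> true) k2 (ltn0Sn m).
have -> : [set G in dissections k x (m.+1 + (k - 2)) | true] = dissections k x
  (m.+1 + (k - 2)).
  by apply/setP => G; rewrite inE andbT.
move=> <-.
rewrite -cardsUI [X in _ = _ + X]eq_card0 ?addn0 => [|G]; last first.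
  by rewrite !inE; case: eqP => [->|]; rewrite ?andbF.
congr #|pred_of_set _|; apply/setP => G; rewrite in_setU !inE.
have [/asboolP C|//] := boolP (`[< dissection k G x m.+1 >]); rewrite /= andbT.
case: (ltngtP 1 (deg G x)) => //.
suff : 0 < deg G x by case: deg => // -[].
apply/card_gt0P; exists [set y; x]; rewrite inE set22 andbT.
by apply: (dissection_unit C) => //; lia.
Qed.

Lemma card_dissections_gt k x m : x < m -> #|dissections k x m| = 0.
Proof.
move=> xm; apply/eqP; rewrite cards_eq0; apply/eqP/setP => G; rewrite !inE.
by apply/asboolP => /dissection_m_le; lia.
Qed.

Lemma card_dissections00 k : #|dissections k ord0 0| = 1.
Proof.
apply/eqP/cards1P; exists finset.set0; apply/setP => G; rewrite !inE.
apply/asboolP/eqP => [C|->].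
  apply/setP => e; rewrite inE; apply/negP =>
    /(dissection_edge C)[a [b [ab bx _]]].
  by move: bx => /=; lia.
split => //.
- by move=> e; rewrite inE.
- by move=> a b c d _ _ _; rewrite /adj inE.
- by move=> a b ->.
- by move=> a b; rewrite /adj inE.
- apply/eqP/cards1P; exists ord0; apply/setP => v; rewrite [RHS]inE.
  apply/idP/eqP => [/uncoveredP[_ vx _]|->]; last exact: uncovered_left.
  by apply/val_inj/eqP; rewrite -leqn0.
Qed.

Lemma card_dissections k x j m : 2 < k -> x = m + (k - 2) * j :> nat ->
  #|dissections k x m| = forest_count k j m.
Proof.
move=> k2; elim: j m x => [|j IHj]; elim=> [|m IHm] x xm.
- by have -> : x = ord0; [apply/val_inj => /=; lia|exact: card_dissections00].
- have yn : m < n by have := ltn_ord x; lia.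
  rewrite (@card_dissectionsS k x (Ordinal yn)) //=; last lia.
  (* With [j = 0] the second summand would need an outer path with more than [x] edges. *)
  by rewrite IHm //= ?card_dissections_gt //; lia.
- apply/eqP; rewrite cards_eq0; apply/eqP/setP => G; rewrite !inE.
  have x0 : 0 < x by rewrite xm add0n muln_gt0; lia.
  by apply/asboolP => /dissection_m_gt0/(_ x0).
- have yn : m + (k - 2) * j.+1 < n by have := ltn_ord x; lia.
  rewrite (@card_dissectionsS k x (Ordinal yn)) //=.
  rewrite IHm //= IHj //; rewrite xm mulnS; lia.
Qed.

(** After [d] peels the outer path has [m + (k - 2) * d] edges and only the unit edge is left at
    [x]; removing it accounts for the predecessor. *)
Lemma card_dissections_deg k x j m (d : nat) : 2 < k -> 0 < m -> 0 < x ->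
  x = m + (k - 2) * d + (k - 2) * j :> nat ->
  #|[set G in dissections k x m | deg G x == d.+1]| =
    forest_count k j (m + (k - 2) * d).-1.
Proof.
move=> k2 m0 x0 xm; elim: d m m0 xm => [|d IHd] m m0 xm.
  have yn : x.-1 < n by have := ltn_ord x; lia.
  case: m m0 xm => // m _ xm.
  rewrite muln0 addn0 /= (@card_deg1 k x (Ordinal yn)) /=; last lia.
  by apply: card_dissections => //=; lia.
have := card_deg_gt1 x (fun e => e == d.+1) k2 m0.
rewrite IHd; [|lia|lia].
have -> : m + (k - 2) + (k - 2) * d = m + (k - 2) * d.+1 by lia.
move=> <-; congr #|pred_of_set _|; apply/setP => G; rewrite !inE.
by congr andb; case: deg => [|[|]].
Qed.

Lemma card_dissections_deg_gt k x m (d : nat) : 2 < k -> 0 < m ->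
  x < m + (k - 2) * d ->
  #|[set G in dissections k x m | deg G x == d.+1]| = 0.
Proof.
move=> k2; elim: d m => [|d IHd] m m0 xm.
  apply/eqP; rewrite -leqn0 -(@card_dissections_gt k x m); last lia.
  by apply/subset_leq_card/subsetP => G; rewrite inE => /andP[].
have := card_deg_gt1 x (fun e => e == d.+1) k2 m0.
rewrite IHd; [|lia|lia].
move=> <-; congr #|pred_of_set _|; apply/setP => G; rewrite !inE.
by congr andb; case: deg => [|[|]].
Qed.

Definition long_edges G : {set 'I_n * 'I_n} :=
  [set e | adj G e.1 e.2 & e.1.+1 < e.2].

(** Removing a long edge raises [m] by [k - 2]; removing a final unit edge lowers [x] and [m] by
    one. Since long edges correspond to cells, this fixes the number of faces. *)
Lemma card_long_edges k G x m : 2 < k -> dissection k G x m ->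
  x = m + (k - 2) * #|long_edges G| :> nat.
Proof.
move=> k2; have [s] := ubnP #|G|; elim: s G x m => // s IH G x m Gs C.
have [x0|x0] := posnP x.
  have -> : #|long_edges G| = 0.
    apply: eq_card0 => -[a b]; rewrite !inE /=; apply/andP => -[abG ab].
    by have := dissection_adj C abG (ltnW ab); lia.
  by have := dissection_m_le C; lia.
have m0 := dissection_m_gt0 C x0.
have yn : x.-1 < n by have := ltn_ord x; lia.
pose y := Ordinal yn; have xy : x = y.+1 :> nat by rewrite /= prednK.
have [[z0 z0x z0G]|nz] := pselect (exists2 z0 : 'I_n, z0.+1 < x & adj G z0 x).
  case: (@arg_minnP _ z0 (fun z => adj G z x && (z < x)) (@nat_of_ord n)).
    by rewrite z0G; lia.
  move=> z /andP[zG zx] zmin.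
  have zmin' z' : adj G z' x -> z' < x -> z <= z'.
    by move=> z'G z'x; apply: zmin; rewrite z'G.
  have zx1 : z.+1 < x by have := zmin' _ z0G; lia.
  have [C' _ _] := dissection_del_long k2 C zx1 zG zmin'.
  have zxG : [set z; x] \in G := zG.
  have Gs' : #|G :\ [set z; x]| < s.
    by rewrite -ltnS; apply: leq_ltn_trans Gs; rewrite (cardsD1 [set z;
      x] G) zxG.
  rewrite {1}(IH _ _ _ Gs' C').
  suff -> : #|long_edges G| = #|long_edges (G :\ [set z; x])|.+1 by lia.
  rewrite (cardsD1 (z, x)) inE zG zx1 add1n.
  congr (#|pred_of_set _|).+1; apply/setP => -[a b]; rewrite !inE /= xpair_eqE.
  have [ab|] := ltnP a.+1 b; last by rewrite !andbF.
  by rewrite adjD1 //; [rewrite !val_eqE -negb_and !andbT andbC|lia].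
have only z : adj G z x -> z < x -> z = y.
  move=> zxG zx; apply/val_inj => /=; apply: contrapT => zy; apply: nz.
  by exists z => //; lia.
have C' := dissection_del_unit xy C only.
have yxG : [set y; x] \in G by apply: (dissection_unit C) => //; lia.
have Gs' : #|G :\ [set y; x]| < s.
  by rewrite -ltnS; apply: leq_ltn_trans Gs; rewrite (cardsD1 [set y; x] G) yxG.
have := IH _ _ _ Gs' C'.
suff -> : long_edges (G :\ [set y; x]) = long_edges G by lia.
apply/setP => -[a b]; rewrite !inE /=.
have [ab|] := ltnP a.+1 b; last by rewrite !andbF.
by rewrite adjD1 //; lia.
Qed.
End Comb.

(** * The recurrence *)

Section Prod.
Local Open Scope nat_scope.

(* C^(M+m) with the factor C^m = (1 - u)^-m expanded in powers of u = z C^(k-2). *)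
Lemma forest_count_add k j M m : 2 < k ->
  forest_count k j (M + m) =
    \sum_(t < j.+1) 'C((m + t).-1, t) * forest_count k (j - t) (M + (k - 2) *
      t).
Proof.
move=> k2; elim: j m M => [|j IHj] m M.
  by rewrite big_ord_recl big_ord0 /= bin0.
elim: m => [|m IHm].
  (* For [m = 0] the truncated predecessor gives ['C(0, 0) = 1] at [t = 0] and zero for every other
     [t], the expansion of C^0 = 1. *)
  rewrite big_ord_recl /= bin0 muln0 !addn0 mul1n big1 ?addn0 // => t _.
  by rewrite add0n bin_small ?mul0n //= /bump leq0n.
(* This is (1 - u)^-(m+1) = (1 - u)^-m + u (1 - u)^-(m+1); the coefficients combine by Pascal's
   rule. *)
rewrite addnS [LHS]/= -/(forest_count k j.+1) IHm.
have -> : M + m + k.-1 = M + (k - 2) + m.+1 by lia.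
rewrite (IHj m.+1 (M + (k - 2))) big_ord_recl [RHS]big_ord_recl /= !bin0 -addnA.
congr addn; rewrite -big_split /=; apply: eq_bigr => t _.
rewrite /bump leq0n /= subSS.
have -> : M + (k - 2) + (k - 2) * t = M + (k - 2) * (1 + t) by rewrite mulnDr;
  lia.
by rewrite -mulnDl addSn !addnS /= -binS add0n.
Qed.

(** The guard matters: for [d >= i] the truncated exponent would be [0] and the value [1] instead of
    [0]. *)
Definition degree_count k i d :=
  if d < i then forest_count k (i - d.+1) ((k - 2) * d.+1) else 0.

Lemma degree_count_rec k r i p : 2 < k -> 1 <= i <= r - 1 -> p < r ->
  degree_count k i.+1 p = \sum_(q < r)
    (if p <= q then 'C(k - 2 + (q - p), k - 3)
     else if p == q.+1 :> nat then 1 else 0) * degree_count k i q.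
Proof.
move=> k2 /andP[i1 ir] pr.
pose F q := (p <= q) * 'C(k - 2 + (q - p), k - 3) * degree_count k i q.
(* Split off the subdiagonal term [q = p - 1] and cut the rest at [i], from where [degree_count k i]
   vanishes; [maxn] keeps the range well formed when [i < p]. *)
have -> : \sum_(q < r) (if p <= q then 'C(k - 2 + (q - p), k - 3)
     else if p == q.+1 :> nat then 1 else 0) * degree_count k i q
  = (0 < p) * degree_count k i p.-1 + \sum_(p <= q < maxn p i) F q.
  transitivity (\sum_(q < r) ((p == q.+1) * degree_count k i q + F q)).
    apply: eq_bigr => q _; rewrite /F; case: leqP => pq.
      by rewrite mul1n; have -> : p == q.+1 = false by lia.
    by rewrite !mul0n addn0; case: eqP.
  rewrite big_split /=; congr addn.
    case: p pr @F => [|p] pr F; first by rewrite big1 // => q _; rewrite mul0n.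
    rewrite (bigD1 (Ordinal (ltnW pr))) //= eqxx big1 ?addn0 // => q /eqP qp.
    rewrite eqSS; case: eqP => [pq|]; last by rewrite mul0n.
    by case: qp; apply/val_inj.
  rewrite -(big_mkord xpredT F) (@big_cat_nat _ _ _ p) //=; last lia.
  rewrite big_nat_cond big1 ?add0n => [|q]; last first.
    by rewrite andbT /F => /andP[_ qp]; rewrite leqNgt qp !mul0n.
  rewrite (@big_cat_nat _ _ _ (maxn p i)) //=; [|lia|lia].
  rewrite [X in _ + X = _]big_nat_cond [X in _ + X = _]big1 ?addn0 // => q.
  rewrite andbT /F /degree_count => /andP[qp _].
  have -> : q < i = false by lia.
  by rewrite muln0.
have [ip|pi] := ltnP i p.
  rewrite big_geq; last lia.
  rewrite /degree_count.
  have -> : p < i.+1 = false by lia.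
  have -> : p.-1 < i = false by lia.
  by rewrite muln0.
rewrite {1}/degree_count ltnS pi subSS.
have -> : (k - 2) * p.+1 = (k - 2) * p + (k - 2) by rewrite mulnS addnC.
rewrite forest_count_add // big_ord_recl /= bin0 mul1n muln0 addn0 subn0;
  congr addn.
  (* The term t = 0 is the subdiagonal one. In the first row it is the coefficient of z^i in C^0,
     which is zero because [i >= 1]. *)
  case: p pr pi {F} => [|p] pr pi; last first.
    by rewrite mul1n /degree_count pi.
  by rewrite muln0 subn0 mul0n; case: i i1 {ir pi}.
(* With [q = t + p] the power of u is [1 + t]; its coefficient is turned into the matrix entry by
   the symmetry of binomials. *)
rewrite -[X in \sum_(X <= _ < _) _]add0n big_addn big_mkord;
  apply: eq_bigr => t _.
rewrite /F leq_addl mul1n addnK /degree_count /bump leq0n /=.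
have -> : t + p < i by have := ltn_ord t; lia.
congr (_ * forest_count k _ _).
- rewrite addnCA add1n /= -bin_sub; last lia.
  by congr 'C(_, _); lia.
- lia.
- by rewrite -mulnDr; congr muln; lia.
Qed.
End Prod.

(** * Orientation in the plane *)

Section Orient.
Import Order.TTheory GRing.Theory Num.Theory numFieldNormedType.Exports.
Local Open Scope ring_scope.
Local Open Scope classical_set_scope.
Variable R : realType.
Implicit Types a b c d x y : plane R.

Lemma planeP x y : x 0 0 = y 0 0 -> x 0 1 = y 0 1 -> x = y.
Proof.
move=> e0 e1; apply/rowP => i; case: i => -[|[|//]] h.
  by rewrite (_ : Ordinal h = 0) //; apply/val_inj.
by rewrite (_ : Ordinal h = 1) //; apply/val_inj.
Qed.

Lemma orientC a b c : orient a b c = orient b c a.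
Proof. by rewrite /orient; ring. Qed.

Lemma orientN a b c : orient b a c = - orient a b c.
Proof. by rewrite /orient; ring. Qed.

Lemma orient_l a c : orient a c a = 0.
Proof. by rewrite /orient; ring. Qed.

Lemma orient_r a c : orient a c c = 0.
Proof. by rewrite /orient; ring. Qed.

Lemma orient_conv a b c d (t : R) :
  orient a b ((1 - t) *: c + t *: d) = (1 - t) * orient a b c + t * orient a b
    d.
Proof. by rewrite /orient !mxE; ring. Qed.

Lemma orient_shift a b c (t : R) : orient a b (c + t *: (b - a)) = orient a b c.
Proof. by rewrite /orient !mxE; ring. Qed.

(** Cramer's rule cleared of denominators, hence valid for flat triangles too. *)
Lemma barycentric a b c x :
  orient a b c *: x =
    orient b c x *: a + orient c a x *: b + orient a b x *: c.
Proof. by apply: planeP; rewrite /orient !mxE; ring. Qed.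

Lemma orient_sum a b c x :
  orient b c x + orient c a x + orient a b x = orient a b c.
Proof. by rewrite /orient; ring. Qed.

Lemma mem_segment a b (t : R) : 0 <= t -> t <= 1 ->
  segment a b ((1 - t) *: a + t *: b).
Proof. by move=> t0 t1; exists t => //=; rewrite in_itv /= t0 t1. Qed.

Lemma segmentC a b : segment a b = segment b a.
Proof.
suff H c d : segment c d `<=` segment d c by apply/seteqP; split; apply: H.
move=> x [t]; rewrite /= in_itv /= => /andP[t0 t1] <-.
rewrite addrC -{1}[t](subKr 1); apply: mem_segment; lra.
Qed.

Lemma segment_l a b : segment a b a.
Proof.
have := @mem_segment a b 0; rewrite subr0 scale1r scale0r addr0.
by apply; rewrite ?ler01.
Qed.

Lemma segment_r a b : segment a b b.
Proof. by rewrite segmentC; apply: segment_l. Qed.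

Lemma segment_orient_ge0 a b c d x : segment c d x ->
  0 <= orient a b c -> 0 <= orient a b d -> 0 <= orient a b x.
Proof.
move=> [t]; rewrite /= in_itv /= => /andP[t0 t1] <- oc od.
by rewrite orient_conv; apply: addr_ge0; apply: mulr_ge0 => //; lra.
Qed.

Lemma segment_orient_le0 a b c d x : segment c d x ->
  orient a b c <= 0 -> orient a b d <= 0 -> orient a b x <= 0.
Proof.
move=> s oc od; rewrite -oppr_ge0 -orientN.
by apply: segment_orient_ge0 s _ _; rewrite orientN oppr_ge0.
Qed.

Lemma conv_gt0 (t u v : R) : 0 <= t -> t <= 1 -> 0 < u -> 0 < v ->
  0 < (1 - t) * u + t * v.
Proof.
move=> t0 t1 u0 v0; have [->|tn] := eqVneq t 0; first by lra.
apply: ltr_wpDl; first by apply: mulr_ge0; lra.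
by apply: mulr_gt0 => //; rewrite lt_def tn.
Qed.

Lemma segment_orient_gt0 a b c d x : segment c d x ->
  0 < orient a b c -> 0 < orient a b d -> 0 < orient a b x.
Proof.
move=> [t]; rewrite /= in_itv /= => /andP[t0 t1] <- oc od.
by rewrite orient_conv; apply: conv_gt0.
Qed.

Lemma segment_orient0 a b x : segment a b x -> orient a b x = 0.
Proof.
by move=> [t _ <-]; rewrite orient_conv orient_l orient_r; lra.
Qed.

(* A point of the line ab is a convex combination of a and b as soon as it is
   on the correct side of some line through a and of some line through b. *)
Lemma line_segment a b c x a1 a2 b1 b2 :
  orient a b c != 0 -> orient a b x = 0 ->
  0 <= orient a1 a2 x -> orient a1 a2 a = 0 -> 0 < orient a1 a2 b ->
  0 <= orient b1 b2 x -> orient b1 b2 b = 0 -> 0 < orient b1 b2 a ->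
  segment a b x.
Proof.
move=> D0 o0 xa aa ab xb bb ba.
have bc := barycentric a b c x; have os := orient_sum a b c x.
rewrite o0 scale0r addr0 in bc; rewrite o0 addr0 in os.
set t := orient c a x / orient a b c.
have E1 : 1 - t = orient b c x / orient a b c.
  by rewrite /t -os; field; rewrite os.
have xE : x = (1 - t) *: a + t *: b.
  rewrite E1 /t; apply: (scalerI D0); rewrite bc scalerDr !scalerA.
  by congr (_ *: _ + _ *: _); field.
rewrite xE; apply: mem_segment.
  by move: xa; rewrite xE orient_conv aa mulr0 add0r pmulr_lge0.
by move: xb; rewrite xE orient_conv bb mulr0 addr0 pmulr_lge0 // subr_ge0.
Qed.

Lemma segment_crossing a b c d :
  orient a b c * orient a b d < 0 -> orient c d a * orient c d b < 0 ->
  exists2 x, segment a b x & segment c d x.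
Proof.
(* An affine function with values [u] and [v] at the ends of a segment vanishes at parameter
   [u / (u - v)]; opposite signs put it in [[0, 1]]. *)
have K a' b' (u v : R) : u * v < 0 -> u - v != 0 /\ (0 <= u / (u - v) <= 1).
  move=> uv; have [v0|v0] := ltP 0 v.
    have u0 : u < 0 by nra.
    have D : u - v < 0 by lra.
    split; first by rewrite lt_eqF.
    by apply/andP; split; [rewrite ler_ndivlMr // mul0r ltW|
       rewrite ler_ndivrMr // mul1r; lra].
  have u0 : 0 < u by nra.
  have D : 0 < u - v by nra.
  split; first by rewrite gt_eqF.
  by apply/andP; split; [rewrite ler_pdivlMr // mul0r ltW|
       rewrite ler_pdivrMr // mul1r; nra].
move=> /(K a b)[nD1 /andP[s0 s1]] /(K c d)[nD2 /andP[t0 t1]].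
exists ((1 - orient c d a / (orient c d a - orient c d b)) *: a
   + (orient c d a / (orient c d a - orient c d b)) *: b).
  exact: mem_segment.
have -> : (1 - orient c d a / (orient c d a - orient c d b)) *: a
   + (orient c d a / (orient c d a - orient c d b)) *: b
  = (1 - orient a b c / (orient a b c - orient a b d)) *: c
   + (orient a b c / (orient a b c - orient a b d)) *: d.
  apply: planeP; rewrite !mxE; move: nD1 nD2; rewrite /orient => nD1 nD2; field;
    by rewrite nD1 nD2.
exact: mem_segment.
Qed.

Lemma orient_continuous a b : continuous (orient a b).
Proof.
move=> x; have F := nbhs_filter x.
have c0 : (fun y : plane R => y 0 0) @ x --> x 0 0 by apply: coord_continuous.
have c1 : (fun y : plane R => y 0 1) @ x --> x 0 1 by apply: coord_continuous.
have kst (u : R) : (fun=> u) y @[y --> x] --> u by exact: (@cvg_cst _ _ _ _ F).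
have k0 := @cvgB _ R^o _ _ F _ _ _ _ c0 (kst (a 0 0)).
have k1 := @cvgB _ R^o _ _ F _ _ _ _ c1 (kst (a 0 1)).
have l0 := @cvgM _ _ _ F _ _ _ _ (kst (b 0 0 - a 0 0)) k1.
have l1 := @cvgM _ _ _ F _ _ _ _ (kst (b 0 1 - a 0 1)) k0.
exact: (@cvgB _ R^o _ _ F _ _ _ _ l0 l1).
Qed.

Lemma connected_segment a b : connected (segment a b).
Proof.
apply: connected_continuous_connected; first exact: segment_connected.
apply: continuous_subspaceT => t.
apply: cvgD; apply: cvgZr_tmp; last exact: cvg_id.
by apply: (@cvgB _ R^o); [exact: cvg_cst|exact: cvg_id].
Qed.

Definition convex_subset (S : set (plane R)) :=
  forall x y, S x -> S y -> segment x y `<=` S.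

Lemma convex_connected (S : set (plane R)) : convex_subset S -> connected S.
Proof.
move=> cS; have [->|/set0P[x Sx]] := eqVneq S set0; first exact: connected0.
rewrite (_ : S = \bigcup_(y in S) segment x y).
  apply: bigcup_connected; last by move=> y _; exact: connected_segment.
  by exists x => y _; exact: segment_l.
apply/seteqP; split => [y Sy|y [z Sz]]; last exact: cS.
by exists y => //; exact: segment_r.
Qed.

Lemma open_halfplane a b : open [set x | 0 < orient a b x].
Proof.
rewrite (_ : [set x | _] = orient a b @^-1` [set u | 0 < u]) //.
by apply: open_comp; [move=> x _; exact: orient_continuous|exact: open_gt].
Qed.

Lemma closed_halfplane a b : closed [set x | 0 <= orient a b x].
Proof.
rewrite (_ : [set x | _] = orient a b @^-1` [set u | 0 <= u]) //.
by apply: preimage_closed; [move=> x _; exact: orient_continuous|exact: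
  closed_ge].
Qed.

Lemma halfplane_unbounded a b x : orient a b x < 0 ->
  ~ bounded_set [set y | orient a b y < 0].
Proof.
move=> ox [M [_ bM]].
have ab : 0 < `|b - a|.
  rewrite normr_gt0 subr_eq0; apply/eqP => E; move: ox.
  by rewrite E orientC orient_l ltxx.
pose N := `|M| + 1; have MN : M < N by rewrite /N; have := ler_norm M; lra.
(* Moving parallel to the boundary line stays in the half-plane; this [s] makes the displacement
   have norm [N + |x| + 1], so the new point has norm above [N]. *)
pose s := (N + `|x| + 1) / `|b - a|.
have := bM _ MN (x + s *: (b - a)); rewrite /= orient_shift => /(_ ox).
have := lerB_normD (s *: (b - a)) x; rewrite [_ *: _ + x]addrC normrZ.
have N0 : 0 <= N + `|x| + 1.
  by rewrite /N; have := normr_ge0 M; have := normr_ge0 x; lra.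
rewrite ger0_norm ?divr_ge0 ?(ltW ab) // /s divfK ?gt_eqF //; lra.
Qed.

Lemma bounded_setS (A B : set (plane R)) : A `<=` B -> bounded_set B ->
  bounded_set A.
Proof. by move=> AB; apply: sub_boundedr => U /=; apply: subset_trans. Qed.

End Orient.

(** * Cyclic order on a set of labels *)

Section Polygon.
Import Order.TTheory GRing.Theory Num.Theory numFieldNormedType.Exports.
Import mathcomp.boot.fintype mathcomp.boot.finset.
Local Open Scope nat_scope.
Variable n : nat.
Implicit Types (V : {set 'I_n}) (s t u v w : 'I_n).

(** [enum V] is increasing, so the cyclic successor in this list is the counter-clockwise successor
    among the corners. *)
Definition next_in V s := next (enum V) s.
Definition prev_in V s := prev (enum V) s.

Lemma next_inK V : cancel (next_in V) (prev_in V).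
Proof. exact: (prev_next (enum_uniq _)). Qed.

Lemma prev_inK V : cancel (prev_in V) (next_in V).
Proof. exact: (next_prev (enum_uniq _)). Qed.

Lemma mem_next_in V s : (next_in V s \in V) = (s \in V).
Proof. by rewrite -!(mem_enum V) mem_next. Qed.

Lemma mem_prev_in V s : (prev_in V s \in V) = (s \in V).
Proof. by rewrite -!(mem_enum V) mem_prev. Qed.

Lemma enum_ord_sorted V : sorted (fun s t => s < t) (enum V).
Proof.
apply: sorted_filter; first by move=> ? ? ?; exact: ltn_trans.
rewrite -enumT; have := iota_ltn_sorted 0 n.
by rewrite -val_enum_ord sorted_map.
Qed.

Lemma next_inP V s : s \in V ->
  (s < next_in V s /\ forall v, v \in V -> s < v -> next_in V s <= v) \/
  (forall v, v \in V -> next_in V s <= v <= s).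
Proof.
move=> sV; have sE : s \in enum V by rewrite mem_enum.
rewrite /next_in next_nth sE.
have srt := enum_ord_sorted V; have inE' v : (v \in enum V) = (v \in V) by
  exact: mem_enum.
case: (enum V) sE srt inE' => // y l sE srt inE'.
have mono i j : i < j -> j < size (y :: l) ->
  nth y (y :: l) i < nth y (y :: l) j.
  by move=> ij jl; apply: (sorted_ltn_nth _ _ srt) => //; [move=> ? ? ?;
    exact: ltn_trans|exact: ltn_trans ij jl].
have idx : index s (y :: l) < size (y :: l) by rewrite index_mem.
have sN : nth y (y :: l) (index s (y :: l)) = s by rewrite nth_index.
move: (index s (y :: l)) idx sN => i idx sN.
(* The default value of [nth] is the head [y]: past the end of the list it yields the wrap-around to
   the least element. *)
have -> : nth y l i = nth y (y :: l) i.+1 by [].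
have vP v : v \in V -> exists2 j, j < size (y :: l) & nth y (y :: l) j = v.
  by rewrite -inE' => /(nthP y).
have [il|li] := ltnP i (size l).
  left; split; first by rewrite -{1}sN; apply: mono.
  move=> v /vP[j jl <-]; rewrite -{1}sN => ij.
  have {}ij : i < j.
    by rewrite ltnNge; apply/negP; rewrite leq_eqVlt =>
      /orP[/eqP h|/mono/(_ idx)];
      [move: ij; rewrite h ltnn|lia].
  by move: ij; rewrite leq_eqVlt => /orP[/eqP->//|/mono/(_ jl)/ltnW].
right => v /vP[j jl <-]; rewrite [nth _ _ i.+1]nth_default //.
have iE : i = size l by apply/eqP; rewrite eqn_leq li -ltnS idx.
apply/andP; split; first by case: j jl => [|j] // /(mono 0)/ltnW; apply.
by rewrite -sN iE; move: jl; rewrite ltnS leq_eqVlt =>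
  /orP[/eqP->//|/mono/(_ (ltnSn _))/ltnW].
Qed.

Lemma card_gt2_third V s t : 2 < #|V| -> exists2 v,
  v \in V & (v != s) && (v != t).
Proof.
move=> V2; have : ~~ (V \subset [set s; t]).
  by apply/negP => /subset_leq_card; rewrite cards2; case: (s != t); lia.
by case/subsetPn => v vV; rewrite !inE negb_or; exists v.
Qed.

Lemma next_in_neq V s : 2 < #|V| -> s \in V -> next_in V s != s.
Proof.
move=> V2 sV; apply/eqP => E; have [v vV /andP[vs _]] := card_gt2_third s s V2.
have vs' : v <> s :> nat by move/val_inj => h; rewrite h eqxx in vs.
by case: (next_inP sV) => [[]|/(_ v vV)]; rewrite E; lia.
Qed.

Lemma next_in_next_in_neq V s : 2 < #|V| -> s \in V ->
  next_in V (next_in V s) != s.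
Proof.
move=> V2 sV; apply/eqP => E; have [v vV /andP[vs vt]] :=
  card_gt2_third s (next_in V s) V2.
have tV : next_in V s \in V by rewrite mem_next_in.
have vs' : v <> s :> nat by move/val_inj => h; rewrite h eqxx in vs.
have vt' : v <> next_in V s :> nat by move/val_inj => h; rewrite h eqxx in vt.
case: (next_inP sV) (next_inP tV) => [[h1 h2]|h1] [[h3 h4]|h3];
  rewrite E in h3 *; try lia.
- by have := h2 v vV; have := h3 v vV; lia.
- by have := h1 v vV; have := h4 v vV; rewrite E; lia.
- by have := h1 v vV; have := h3 v vV; lia.
Qed.

Lemma prev_in_neq_next_in V s : 2 < #|V| -> s \in V ->
  prev_in V s != next_in V s.
Proof.
move=> V2 sV; apply/eqP => E; have := @next_in_next_in_neq V (prev_in V s) V2.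
by rewrite mem_prev_in prev_inK => /(_ sV); rewrite E eqxx.
Qed.

End Polygon.

(** * Convex polygons cut out by the half-planes of their sides *)

Section ConvexPolygon.
Import Order.TTheory GRing.Theory Num.Theory numFieldNormedType.Exports.
Import mathcomp.boot.fintype mathcomp.boot.finset.
Local Open Scope ring_scope.
Local Open Scope classical_set_scope.
Variables (R : realType) (n : nat) (p : 'I_n -> plane R).
Hypothesis ccw : ccw_labelled p.
Implicit Types (V : {set 'I_n}) (s t u v w : 'I_n) (x y z : plane R).

Lemma ccw_gt0 s t v : [|| s < t < v, t < v < s | v < s < t]%N ->
  0 < orient (p s) (p t) (p v).
Proof.
case/or3P => /andP[h1 h2]; first exact: ccw.
  by rewrite orientC; apply: ccw.
by rewrite -orientC; apply: ccw.
Qed.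

Lemma ccw_lt0 s t v : [|| t < s < v, s < v < t | v < t < s]%N ->
  orient (p s) (p t) (p v) < 0.
Proof. by move=> h; rewrite orientN oppr_lt0; apply: ccw_gt0. Qed.

Lemma ccw_le0 s t u : (s <= u <= t)%N || (t < s)%N && ((u <= t)%N || (s <=
  u)%N) ->
  orient (p s) (p t) (p u) <= 0.
Proof.
move=> h; have [->|us] := eqVneq u s; first by rewrite orient_l.
have [->|ut] := eqVneq u t; first by rewrite orient_r.
apply/ltW/ccw_lt0; move: us ut; rewrite -!val_eqE /=; lia.
Qed.

Lemma ccw_ge0 s t u : (t <= u <= s)%N || (s < t)%N && ((u <= s)%N || (t <=
  u)%N) ->
  0 <= orient (p s) (p t) (p u).
Proof. by move=> h; rewrite orientN oppr_ge0; apply: ccw_le0. Qed.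

Lemma ccw_neq0 s t v : s != t -> t != v -> s != v ->
  orient (p s) (p t) (p v) != 0.
Proof.
rewrite -!val_eqE /= => st tv sv.
have [h|h] := boolP [|| s < t < v, t < v < s | v < s < t]%N.
  by rewrite gt_eqF // ccw_gt0.
by rewrite lt_eqF // ccw_lt0 //; lia.
Qed.

Lemma vertex_segment s t v : s != t -> segment (p s) (p t) (p v) ->
  v = s \/ v = t.
Proof.
move=> st /segment_orient0 o0; apply: contrapT => /not_orP[/eqP vs /eqP vt].
by have := @ccw_neq0 s t v st; rewrite o0 eqxx eq_sym vt eq_sym vs =>
  /(_ isT isT).
Qed.

(** Half-planes rather than convex hulls: convexity and openness are then immediate, and membership
    is a sign condition at each side. *)
Definition opolygon V : set (plane R) :=
  [set x | forall s, s \in V -> 0 < orient (p s) (p (next_in V s)) x].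
Definition cpolygon V : set (plane R) :=
  [set x | forall s, s \in V -> 0 <= orient (p s) (p (next_in V s)) x].
Definition bdry V : set (plane R) :=
  \bigcup_(s in [set` V]) segment (p s) (p (next_in V s)).

Lemma opolygon_cpolygon V : opolygon V `<=` cpolygon V.
Proof. by move=> x Px s sV; apply/ltW/Px. Qed.

Lemma opolygon_convex V : convex_subset (opolygon V).
Proof. by move=> x y Px Py z xyz s sV; apply: segment_orient_gt0 xyz _ _;
  auto. Qed.

Lemma cpolygon_closed V : closed (cpolygon V).
Proof.
rewrite (_ : cpolygon V = \bigcap_(s in [set` V]) [set x | 0 <= orient (p s) (p
  (next_in V s)) x]).
  by apply: closed_bigI => s _; exact: closed_halfplane.
by apply/seteqP; split => x h s; apply: h.
Qed.

Lemma opolygon_open V : open (opolygon V).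
Proof.
rewrite (_ : opolygon V =
   ~` \bigcup_(s in [set` V]) ~` [set x | 0 < orient (p s) (p (next_in V s))
     x]).
  apply: closed_openC; apply: closed_bigcup; first exact: finite_finset.
  by move=> s _; apply: open_closedC; exact: open_halfplane.
apply/seteqP; split => x.
  by move=> h [s /= sV]; apply; exact: h.
by move=> h s sV; apply: contrapT => ns; apply: h; exists s.
Qed.

Section Fixed.
Variable V : {set 'I_n}.
Hypothesis V2 : (2 < #|V|)%N.

Lemma orient_next_in_gt0 s v : s \in V -> v \in V -> v != s ->
  v != next_in V s ->
  0 < orient (p s) (p (next_in V s)) (p v).
Proof.
move=> sV vV; rewrite -!val_eqE /= => vs vt; apply: ccw_gt0.
by case: (next_inP sV) => [[h1 /(_ v vV) h2]|/(_ v vV) h]; lia.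
Qed.

Lemma orient_next_in_ge0 s v : s \in V -> v \in V ->
  0 <= orient (p s) (p (next_in V s)) (p v).
Proof.
move=> sV vV; have [->|vs] := eqVneq v s; first by rewrite orient_l.
have [->|vt] := eqVneq v (next_in V s); first by rewrite orient_r.
exact/ltW/orient_next_in_gt0.
Qed.

(** At most one of the two sides at [s] ends in [t]; the other one spans the required line. This
    provides the side conditions of [line_segment]. *)
Lemma cpolygon_side s t x : s \in V -> t \in V -> s != t -> cpolygon V x ->
  exists a b, [/\ 0 <= orient a b x, orient a b (p s) = 0 & 0 < orient a b (p
    t)].
Proof.
move=> sV tV st Px; have [tn|tn] := eqVneq t (next_in V s).
  exists (p (prev_in V s)), (p s); have pV : prev_in V s \in V by rewrite
    mem_prev_in.
  have := Px _ pV; have := @orient_next_in_gt0 _ _ pV tV;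
    rewrite prev_inK eq_sym [t == s]eq_sym st.
  by rewrite tn prev_in_neq_next_in // => /(_ isT isT) h1 h2; rewrite orient_r.
exists (p s), (p (next_in V s)); split; [exact: Px|exact: orient_l|].
by apply: orient_next_in_gt0; rewrite // eq_sym.
Qed.

Lemma cpolygon_chord s t x : s \in V -> t \in V -> s != t -> cpolygon V x ->
  orient (p s) (p t) x = 0 -> segment (p s) (p t) x.
Proof.
move=> sV tV st Px o0; have [v vV /andP[vs vt]] := card_gt2_third s t V2.
have [a1 [a2 [xa aa ab]]] := cpolygon_side sV tV st Px.
have ts : t != s by rewrite eq_sym.
have [b1 [b2 [xb bb ba]]] := cpolygon_side tV sV ts Px.
apply: (line_segment (c := p v)) xa aa ab xb bb ba => //.
by apply: ccw_neq0; rewrite // eq_sym.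
Qed.

Lemma cpolygon_bdry : cpolygon V `\` opolygon V = bdry V.
Proof.
apply/seteqP; split => [x [Px nPx]|x [s /= sV sx]].
  have /existsNP[s /not_implyP[sV /negP so]] := nPx.
  exists s => //; apply: cpolygon_chord => //.
  - by rewrite mem_next_in.
  - by rewrite eq_sym next_in_neq.
  - by apply/le_anti/andP; split; [rewrite leNgt; exact: so|exact: Px].
split; last by move=> /(_ s sV); rewrite (segment_orient0 sx) ltxx.
by move=> t tV; apply: segment_orient_ge0 sx _ _; apply: orient_next_in_ge0;
  rewrite ?mem_next_in.
Qed.

Lemma opolygon_nonempty : opolygon V !=set0.
Proof.
have /card_gt0P[s sV] : (0 < #|V|)%N by lia.
have tV : next_in V s \in V by rewrite mem_next_in.
have [v vV /andP[vs vt]] := card_gt2_third s (next_in V s) V2.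
have st : s != next_in V s by rewrite eq_sym next_in_neq.
(* The witness has weights 1/4, 1/4, 1/2 on three corners. No side line contains all three, so one
   of the nonnegative terms is positive. *)
pose m := (1 - 2^-1) *: p s + 2^-1 *: p (next_in V s).
exists ((1 - 2^-1) *: m + 2^-1 *: p v) => w wV.
rewrite !orient_conv.
have h1 := orient_next_in_ge0 wV sV; have h2 := orient_next_in_ge0 wV tV.
have h3 := orient_next_in_ge0 wV vV.
have [vw|vw] := eqVneq v w; last first.
  have [vw'|vw'] := eqVneq v (next_in V w); last first.
    by have := orient_next_in_gt0 wV vV vw vw'; lra.
  have [sw|sw] := eqVneq s w.
    by move: vt; rewrite vw' sw eqxx.
  have sw' : s != next_in V w by rewrite -vw' eq_sym.
  by have := orient_next_in_gt0 wV sV sw sw'; lra.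
subst w; have [sn|sn] := eqVneq s (next_in V v).
  have tv : next_in V s != v by rewrite eq_sym.
  have tn : next_in V s != next_in V v by rewrite -sn eq_sym.
  by have := orient_next_in_gt0 wV tV tv tn; lra.
have sv : s != v by rewrite eq_sym.
by have := orient_next_in_gt0 wV sV sv sn; lra.
Qed.

Lemma closure_opolygon : closure (opolygon V) = cpolygon V.
Proof.
apply/seteqP; split.
  by rewrite [X in _ `<=` X](closure_id _).1;
    [exact/closureS/opolygon_cpolygon|exact: cpolygon_closed].
move=> x Px B /nbhs_ballP[e /= e0 Be]; have [z Pz] := opolygon_nonempty.
(* A short step from [x] towards an interior point [z] enters the open polygon. The summand [e]
   keeps [N] positive when [z = x], and [t * N = e / 2] keeps the step inside the ball. *)
pose N := `|z - x| + e; have N0 : 0 < N by rewrite /N ltr_wpDl.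
pose t := e / (2 * N).
have t0 : 0 < t by rewrite /t divr_gt0 // mulr_gt0.
have t1 : t < 1 by rewrite /t ltr_pdivrMr ?mulr_gt0 // mul1r /N;
  have := normr_ge0 (z - x); lra.
exists ((1 - t) *: x + t *: z); split.
  move=> s sV; rewrite orient_conv; have := Px s sV; have := Pz s sV; nra.
apply: Be; rewrite -ball_normE /ball_ /=.
have -> : x - ((1 - t) *: x + t *: z) = t *: (x - z).
  by apply: planeP; rewrite !mxE; ring.
rewrite normrZ gtr0_norm // distrC /t mulrAC ltr_pdivrMr ?mulr_gt0 //.
by rewrite ltr_pM2l // /N; have := normr_ge0 (z - x); lra.
Qed.

Lemma interior_opolygon : interior (opolygon V) = opolygon V.
Proof. by apply/seteqP; split; [exact: interior_subset|rewrite -open_subsetE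
  //; exact: opolygon_open]. Qed.

Lemma frontier_opolygon : closure (opolygon V) `\` interior (opolygon V) = bdry
  V.
Proof. by rewrite closure_opolygon interior_opolygon cpolygon_bdry. Qed.

(** The sum is twice the signed area: the parts depending on [x] cancel around the polygon because
    [next_in V] permutes [V]. *)
Lemma sum_orient_next_in x : \sum_(s in V) orient (p s) (p (next_in V s)) x =
  \sum_(s in V) orient (p s) (p (next_in V s)) 0.
Proof.
pose cr y : R := y 0 0 * x 0 1 - y 0 1 * x 0 0.
have E s : orient (p s) (p (next_in V s)) x =
    orient (p s) (p (next_in V s)) 0 + (cr (p (next_in V s)) - cr (p s)).
  by rewrite /orient /cr !mxE; ring.
rewrite (eq_bigr _ (fun s _ => E s)) big_split /= [X in _ + X]sumrB.
have -> : \sum_(s in V) cr (p s) = \sum_(s in V) cr (p (next_in V s)).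
  rewrite (reindex_inj (can_inj (@next_inK n V))) /=.
  by apply: eq_bigl => s; rewrite mem_next_in.
by rewrite subrr addr0.
Qed.

(** The side functions are nonnegative with constant sum [A], so each is at most [A]. Those of two
    adjacent sides are, up to the factor [D], affine coordinates with origin at the common corner
    [p t]. *)
Lemma opolygon_bounded : bounded_set (opolygon V).
Proof.
have /card_gt0P[s sV] : (0 < #|V|)%N by lia.
set t := next_in V s; have tV : t \in V by rewrite mem_next_in.
set w := next_in V t; have wV : w \in V by rewrite mem_next_in.
pose A := \sum_(s in V) orient (p s) (p (next_in V s)) 0.
have ub x v : opolygon V x -> v \in V -> orient (p v) (p (next_in V v)) x <= A.
  move=> Px vV; rewrite /A -(sum_orient_next_in x) (bigD1 v) //= lerDl.
  by apply: sumr_ge0 => u /andP[uV _]; apply/ltW/Px.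
pose D := orient (p s) (p t) (p w).
have D0 : 0 < D.
  by apply: orient_next_in_gt0 => //; [exact: next_in_next_in_neq|exact:
    next_in_neq].
pose M := `|p t| + A / D * (`|p s - p t| + `|p w - p t|).
exists M; split; first exact: num_real.
move=> N MN x Px; apply: le_trans (ltW MN).
have f0 := ltW (Px _ sV); have fA := ub _ _ Px sV.
have g0 := ltW (Px _ tV); have gA := ub _ _ Px tV.
have xE : x = p t + ((orient (p t) (p w) x / D) *: (p s - p t)
                  + (orient (p s) (p t) x / D) *: (p w - p t)).
  have os := orient_sum (p s) (p t) (p w) x.
  apply: (scalerI (lt0r_neq0 D0)); rewrite /D barycentric -/D.
  rewrite scalerDr scalerDr !scalerA ![D * _]mulrC !divfK ?gt_eqF //.
  have -> : D = orient (p t) (p w) x + orient (p w) (p s) x + orient (p s) (p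
    t) x by rewrite os.
  by apply: planeP; rewrite !mxE; ring.
rewrite [in leLHS]xE (le_trans (ler_normD _ _)) // /M lerD2l.
rewrite (le_trans (ler_normD _ _)) // normrZ [X in _ + X <= _]normrZ mulrDr.
have bnd f : 0 <= f -> f <= A -> `|f / D| <= A / D.
  move=> f0' fA'; rewrite ger0_norm; last by apply: divr_ge0 => //; exact: ltW.
  by rewrite ler_pM2r // invr_gt0.
by apply: lerD; (apply: ler_wpM2r; [exact: normr_ge0|exact: bnd]).
Qed.

Lemma vertex_bdry v : bdry V (p v) -> v \in V.
Proof.
move=> [s /= sV]; have st : s != next_in V s by rewrite eq_sym next_in_neq.
by move/(vertex_segment st) => [->|->] //; rewrite mem_next_in.
Qed.

Lemma bdry_vertex v : v \in V -> bdry V (p v).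
Proof. by move=> vV; exists v => //; apply: segment_l. Qed.

(* The open polygon is open and closed relatively to the complement of S. *)
Lemma opolygon_component (S : set (plane R)) x : bdry V `<=` S ->
  opolygon V `<=` ~` S ->
  opolygon V x -> connected_component (~` S) x = opolygon V.
Proof.
move=> bS PnS Px.
have sub : opolygon V `<=` connected_component (~` S) x.
  apply: connected_component_max => //.
  exact/convex_connected/opolygon_convex.
apply/seteqP; split => //.
have conn : connected (connected_component (~` S) x) by exact:
  component_connected.
have <- // : opolygon V = connected_component (~` S) x.
apply: conn; first by exists x.
  by exists (opolygon V); [exact: opolygon_open|rewrite classical_sets.setIidr].
exists (cpolygon V); first exact: cpolygon_closed.
apply/seteqP; split => y; first by move=> Py; split;
  [exact: sub|exact: opolygon_cpolygon].
move=> [Cy Qy]; apply: contrapT => nPy.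
have : bdry V y by rewrite -cpolygon_bdry.
by move=> /bS; apply: (connected_component_sub Cy).
Qed.
End Fixed.
End ConvexPolygon.

(** * Cells of a dissection *)

Section Cells.
Import mathcomp.boot.fintype mathcomp.boot.finset.
Local Open Scope set_scope.
Local Open Scope nat_scope.
Variable n' : nat.
Local Notation n := n'.+1.
Implicit Types (G H : graph n) (a b c d s t u v w x y : 'I_n).

(** Take the farthest neighbour [d] of [s] with [s < d <= b]; a unit edge ensures one exists. It is
    not beyond [t], which it would hide, and an edge hiding [d] would hide [s], cross [sd] or reach
    farther from [s]. So [d] is uncovered, hence equal to [t]. *)
Lemma uncovered_step H a b s t : noncrossing H ->
  (forall c d, d = c.+1 :> nat -> a <= c -> d <= b -> adj H c d) ->
  s \in uncovered H a b -> t \in uncovered H a b -> s < t ->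
  (forall v, v \in uncovered H a b -> s < v -> t <= v) -> adj H s t.
Proof.
move=> nc unit sU tU st st_next.
have [as_ sb sK] := uncoveredP _ _ _ _ sU; have [at_ tb tK] :=
  uncoveredP _ _ _ _ tU.
have s1n : s.+1 < n by have := ltn_ord t; lia.
pose Q d := [&& adj H s d, s < d & d <= b].
have Q1 : Q (Ordinal s1n) by rewrite /Q unit //=; lia.
case: (arg_maxnP (@nat_of_ord n) Q1) => d /and3P[sd sltd db] dmax.
have dt : d <= t by rewrite leqNgt; apply/negP => td; exact: (tK s d).
suff dU : d \in uncovered H a b.
  have td := st_next _ dU sltd.
  by have -> : t = d by apply/val_inj/eqP; rewrite eqn_leq /= td dt.
apply/uncoveredP; split => //; first lia.
move=> c e ce ac eb cd de; have [cs|sc] := ltnP c s.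
  by apply: (sK c e) => //; lia.
have [cs|/eqP cs] := eqVneq c s; last first.
  by apply: (nc s d c e) => //; move/eqP: cs; rewrite -val_eqE /=; lia.
by subst c; have := dmax e; rewrite /Q ce eb /= andbT => h;
  have := h (ltn_trans sltd de); lia.
Qed.

Definition cell G a b := uncovered (G :\ [set a; b]) a b.

Section Dissection.
Variable G : graph n.
Hypothesis nc : noncrossing G.
Hypothesis unit : forall c d, d = c.+1 :> nat -> adj G c d.

Lemma adj_neq u v : loopless G -> adj G u v -> u != v.
Proof.
move=> loop uv; have := forallP loop [set u; v];
  rewrite -/(adj G u v) uv /= cards2.
by case: (u != v).
Qed.

Section Cell.
Variables a b : 'I_n.
Hypothesis ab : a.+1 < b.

Lemma cell_step s t : s \in cell G a b -> t \in cell G a b -> s < t ->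
  (forall v, v \in cell G a b -> s < v -> t <= v) -> adj (G :\ [set a; b]) s t.
Proof.
apply: uncovered_step.
  by apply: noncrossing_sub nc => c d cd; rewrite adjD1 //; [case/andP|lia].
by move=> c d cd ac db; rewrite adjD1 ?unit //; lia.
Qed.

Lemma cell_a : a \in cell G a b.
Proof. by apply: uncovered_left; lia. Qed.

Lemma cell_b : b \in cell G a b.
Proof. by apply: uncovered_right; lia. Qed.

Lemma cell_bounds s : s \in cell G a b -> a <= s <= b.
Proof. by case/uncoveredP => -> ->. Qed.

(** If [a] and [b] were the only corners, they would be consecutive and so joined in the graph from
    which [ab] was removed. *)
Lemma cell_gt2 : 2 < #|cell G a b|.
Proof.
have ne : a != b by rewrite -val_eqE /=; lia.
rewrite ltnNge; apply/negP => le2.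
have E : [set a; b] = cell G a b.
  apply/eqP; rewrite eqEcard cards2 ne le2 andbT.
  by apply/subsetP => v /set2P[]->; [exact: cell_a|exact: cell_b].
have := cell_step cell_a cell_b; rewrite adjD1 ?eqxx ?andbF; try lia.
move=> h; suff : false by []; apply: h; first lia.
by move=> v; rewrite -E => /set2P[]->; lia.
Qed.

Lemma cell_next_in_b : next_in (cell G a b) b = a.
Proof.
have nV : next_in (cell G a b) b \in cell G a b by rewrite mem_next_in cell_b.
have := cell_bounds nV; case: (next_inP cell_b) => [[]|/(_ _ cell_a)];
  first lia.
by move=> ? ?; apply/val_inj => /=; lia.
Qed.

Lemma cell_next_in s : s \in cell G a b -> s != b ->
  s < next_in (cell G a b) s /\ adj (G :\ [set a;
    b]) s (next_in (cell G a b) s).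
Proof.
rewrite -val_eqE /= => sV sb; have := cell_bounds sV.
case: (next_inP sV) => [[h1 h2] _|/(_ _ cell_b)]; last lia.
by split => //; apply: cell_step => //; rewrite mem_next_in.
Qed.

Hypothesis abG : adj G a b.

Lemma cell_adj s : s \in cell G a b -> adj G s (next_in (cell G a b) s).
Proof.
move=> sV; have [->|sb] := eqVneq s b; first by rewrite cell_next_in_b adjC.
have [h] := cell_next_in sV sb; rewrite adjD1 //; last lia.
by case/andP.
Qed.

(* Every edge of G lies in the closed outer half-plane of one side of the cell. *)
Lemma edge_cell_side u v : adj G u v -> u < v ->
  exists2 s, s \in cell G a b & let t := next_in (cell G a b) s in
    [/\ s < t, s <= u & v <= t] \/
    [/\ t < s, (u <= t) || (s <= u) & (v <= t) || (s <= v)].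
Proof.
move=> uvG uv.
have [/andP[au vb]|out] := boolP ((a <= u) && (v <= b)); last first.
  exists b; first exact: cell_b.
  rewrite cell_next_in_b /=; right.
  have n1 : u < a -> a < v -> v < b -> False by move=> *;
    exact: (nc (a:=u) (b:=v) (c:=a) (d:=b)).
  have n2 : a < u -> u < b -> b < v -> False by move=> *;
    exact: (nc (a:=a) (b:=b) (c:=u) (d:=v)).
  have [ua|ua] := ltnP u a.
    have [av|av] := ltnP a v; last by split; lia.
    have [vb|vb] := ltnP v b; [by case: (n1 ua av vb)|split; lia].
  have bv : b < v by lia.
  have [au|au] := ltnP a u; last by split; lia.
  have [ub|ub] := ltnP u b; [by case: (n2 au ub bv)|split; lia].
have [/andP[/eqP/val_inj ua /eqP/val_inj va]|ne] :=
  boolP ((u == a :> nat) && (v == b :> nat)).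
  by exists b; [exact: cell_b|rewrite cell_next_in_b ua va; right; split; lia].
(* Let [s] be the last corner at or before [u], and [t] its successor. Then [u < t], and an edge
   [uv] going past [t] would hide it. *)
pose Q s := (s \in cell G a b) && (s <= u).
have Qa : Q a by rewrite /Q cell_a.
case: (arg_maxnP (@nat_of_ord n) Qa) => s /andP[sV su] smax.
exists s => //=; left.
have sb : s != b by rewrite -val_eqE /=; lia.
have [st _] := cell_next_in sV sb; set t := next_in _ s in st *.
have tV : t \in cell G a b by rewrite mem_next_in.
have ut : u < t.
  by rewrite ltnNge; apply/negP => tu; have := smax t;
    rewrite /Q tV tu => /(_ isT); lia.
split => //; rewrite leqNgt; apply/negP => tv.
case/uncoveredP: tV => _ _ /(_ u v); apply => //.
by rewrite adjD1 // ?uvG ?(ltnW ab) //=; move: ne; rewrite negb_and.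
Qed.

End Cell.
End Dissection.
End Cells.

(** * 2-connectivity and hull edges *)

Section Connectivity.
Import mathcomp.boot.fintype mathcomp.boot.finset.
Local Open Scope set_scope.
Local Open Scope nat_scope.
Variable n' : nat.
Local Notation n := n'.+1.
Variable G : graph n.
Implicit Types (a b c d s t u v w x y : 'I_n) (X W : {set 'I_n}).

Let avoid X : rel 'I_n := [rel u v | [&& adj G u v, u \notin X & v \notin X]].

Lemma connect_avoid_sym X : connect_sym (avoid X).
Proof.
apply: sym_connect_sym => u v.
by apply/and3P/and3P => -[uv uX vX]; split; rewrite // adjC.
Qed.

Lemma connect_avoid_chain X x y :
  (forall c d, d = c.+1 :> nat -> adj G c d) -> x <= y ->
  (forall w, x <= w <= y -> w \notin X) -> connect (avoid X) x y.
Proof.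
move=> unit; have [m] := ubnP (y - x); elim: m x => // m IH x ym xy nX.
have [/eqP xy'|ne] := eqVneq (x : nat) y.
  by rewrite (val_inj (eqP xy')); exact: connect0.
have x1 : x.+1 < n by have := ltn_ord y; lia.
pose x' := Ordinal x1.
have xX : x \notin X by apply: nX; lia.
have xX' : x' \notin X by apply: nX => /=; lia.
apply: (@connect_trans _ _ x'); last by apply: IH => [| |w] /=;
  [lia|lia|move=> h; apply: nX; lia].
by apply/connect1/and3P; split => //; exact: unit.
Qed.

(** The hull is a cycle, and at most one vertex is deleted: if it lies between [x] and [y], the path
    goes round through the edge from [0] to the last label. *)
Lemma hull_2connected : 2 < n ->
  (forall c d, d = c.+1 :> nat -> adj G c d) -> adj G ord0 ord_max ->
  k_connected 2 G.
Proof.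
move=> n2 unit hull; split => // X X2 x y xX yX; rewrite -/(avoid X).
wlog xy : x y xX yX / x <= y.
  move=> W; have [xy|/ltnW yx] := leqP x y; first exact: W.
  by rewrite connect_avoid_sym; exact: W.
have [[w /andP[/andP[xw wy] wX]]|nw] :=
  pselect (exists w, (x <= w <= y) && (w \in X)); last first.
  apply: connect_avoid_chain => // w xwy; apply/negP => wX; apply: nw.
  by exists w; rewrite xwy wX.
have Xw v : v \in X -> v = w.
  move=> vX; apply/eqP; apply: contraLR X2 => vw; rewrite -leqNgt.
  have <- : #|[set v; w]| = 2 by rewrite cards2 vw.
  by apply/subset_leq_card/subsetP => z /set2P[]->.
have xw' : x != w by apply: contraNneq xX => ->.
have yw' : y != w by apply: contraNneq yX => ->.
move: xw' yw'; rewrite -!val_eqE /= => xw' yw'.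
have c1 : connect (avoid X) ord0 x.
  apply: connect_avoid_chain => // v /andP[_ vx].
  by apply/negP => /Xw E; subst v; lia.
have c2 : connect (avoid X) y ord_max.
  apply: connect_avoid_chain => //; first exact: leq_ord.
  by move=> v /andP[yv _]; apply/negP => /Xw E; subst v; lia.
rewrite connect_avoid_sym in c1; apply: (connect_trans c1).
rewrite connect_avoid_sym in c2; apply: connect_trans c2.
apply/connect1/and3P; split => //; apply/negP => /Xw E.
  by move: xw xw'; rewrite -E /=; lia.
by move: wy yw'; rewrite -E /=; have := leq_ord y; lia.
Qed.

Hypothesis nc : noncrossing G.

Lemma connect_closed X W x y : connect (avoid X) x y -> x \in W ->
  (forall c d, c \in W -> d \notin W -> c \notin X -> d \notin X ->
    ~~ adj G c d) ->
  y \in W.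
Proof.
move=> /connectP[l pl ->] + closed; elim: l x pl =>
  //= z l IH x /andP[/and3P[xz xX zX] pl] xW.
apply: IH pl _; apply: contraT => zW.
by have := closed _ _ xW zW xX zX; rewrite xz.
Qed.

(* Let b be the neighbour of s that comes last when turning counter-clockwise
   from s: if the hull edge ts is missing, then removing b separates s from t.
     *)
Lemma hull_edge s t : k_connected 2 G ->
  (s = t.+1 :> nat \/ s = 0 :> nat /\ t = n' :> nat) -> adj G t s.
Proof.
move=> [n2 conn] st; apply: contraT => nts.
have tmax : t <= n' := leq_ord t.
have ne : s != t by rewrite -val_eqE /=; lia.
have cut b W : s \in W -> t \notin W -> s != b -> t != b ->
    (forall c d, c \in W -> d \notin W -> c != b -> d != b -> ~~ adj G c d) ->
      False.
  move=> sW tW sb tb closed.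
  have := conn [set b]; rewrite cards1 => /(_ isT s t).
  rewrite !inE => /(_ sb tb) /connect_closed /(_ sW).
  move=> h; case/negP: tW; apply: h => c d cW dW; rewrite !inE; exact: closed.
(* Counter-clockwise from [s] the labels above [s] come first and those below it last, so [b] is the
   largest neighbour below [s] if there is one, otherwise the largest above. The separated set is
   the arc from [s] up to but excluding [b]. *)
have [[b0 b0s b0G]|nb] := pselect (exists2 b : 'I_n, b < s & adj G b s).
  case: (@arg_maxnP _ b0 (fun b => (b < s) && adj G b s) (@nat_of_ord n)).
    by rewrite b0s.
  move=> b /andP[bs bG] bmax.
  have bt : b != t by apply: contraNneq nts => <-.
  move: (bt); rewrite -val_eqE /= => bt'.
  apply/negP => _; apply: (cut b [set v : 'I_n | (s <= v) || (v < b)]);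
    rewrite ?inE.
  - by rewrite leqnn.
  - lia.
  - by rewrite -val_eqE /=; lia.
  - by rewrite eq_sym.
  move=> c d; rewrite !inE -!val_eqE /= => cW dW cb db; apply/negP => cd.
  have [cs|cs] := eqVneq c s.
    subst c; have := bmax d; rewrite adjC cd andbT => /(_ _); lia.
  move: cs; rewrite -val_eqE /= => cs.
  have [sc|cs'] := ltnP s c.
    by apply: (nc (a:=b) (b:=s) (c:=d) (d:=c)); rewrite // 1?adjC //; lia.
  by apply: (nc (a:=c) (b:=d) (c:=b) (d:=s)) => //; lia.
(* An isolated [s] would be separated from [t] by deleting any third vertex. *)
have [b0 b0s b0G] : exists2 b : 'I_n, s < b & adj G s b.
  apply: contrapT => nb'.
  have [|b _ /andP[bs bt]] := @card_gt2_third n [set: 'I_n] s t.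
    by rewrite cardsT card_ord.
  apply: (cut b [set s]); rewrite ?inE // 1?eq_sym //.
  move=> c d /set1P-> {c} ds _ _; apply/negP => sd.
  move: ds; rewrite inE -val_eqE /= => ds; have [h|h] := ltnP d s.
    by apply: nb; exists d; rewrite // adjC.
  by apply: nb'; exists d; rewrite //; lia.
case: (@arg_maxnP _ b0 (fun b => (s < b) && adj G s b) (@nat_of_ord n)).
  by rewrite b0s.
move=> b /andP[sb bG] bmax.
have bt : b != t by apply: contraNneq nts => <-; rewrite adjC.
move: (bt); rewrite -val_eqE /= => bt'; have := leq_ord b => bn.
apply/negP => _; apply: (cut b [set v : 'I_n | (s <= v) && (v < b)]);
  rewrite ?inE.
- by rewrite leqnn.
- lia.
- by rewrite -val_eqE /=; lia.
- by rewrite eq_sym.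
move=> c d; rewrite !inE -!val_eqE /= => cW dW cb db; apply/negP => cd.
have [cs|cs] := eqVneq c s.
  subst c; have [h|h] := ltnP d s; first by apply: nb; exists d;
    rewrite // adjC.
  by have := bmax d; rewrite cd andbT => /(_ _); lia.
move: cs; rewrite -val_eqE /= => cs.
have [ds|ds] := ltnP d s.
  by apply: (nc (a:=d) (b:=c) (c:=s) (d:=b)); rewrite // 1?adjC //; lia.
by apply: (nc (a:=s) (b:=b) (c:=c) (d:=d)) => //; lia.
Qed.
End Connectivity.

(** * Faces *)

Section Faces.
Import Order.TTheory GRing.Theory Num.Theory numFieldNormedType.Exports.
Import mathcomp.boot.fintype mathcomp.boot.finset.
Local Open Scope ring_scope.
Local Open Scope classical_set_scope.
Variables (R : realType) (n' : nat).
Local Notation n := n'.+1.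
Variable p : 'I_n -> plane R.
Hypothesis ccw : ccw_labelled p.
Variable G : graph n.
Implicit Types (a b c d s t u v w : 'I_n) (x y z : plane R).

Lemma plane_noncrossing : plane_graph p G -> noncrossing G.
Proof.
move=> pl a b c d ac cb bd abG cdG.
have [||x abx cdx] := @segment_crossing R (p a) (p b) (p c) (p d).
- by rewrite nmulr_rlt0 ?ccw_gt0 ?ccw_lt0 //; lia.
- by rewrite pmulr_rlt0 ?ccw_gt0 ?ccw_lt0 //; lia.
have ne : [set a; b]%SET != [set c; d]%SET.
  apply/eqP => /(edge_inj (ltn_trans ac cb) (ltn_trans cb bd))[E _].
  by move: ac; rewrite E ltnn.
have [|v /= + _] := pl _ _ abG cdG ne x.
  by split; [exists a, b|exists c, d].
by rewrite !inE => /andP[/orP[]/eqP-> /orP[]/eqP E]; subst; lia.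
Qed.

Lemma adj_drawing u v : adj G u v -> segment (p u) (p v) `<=` drawing p G.
Proof. by move=> uv x ux; exists [set u; v]%SET => //; exists u, v. Qed.

Hypothesis nc : noncrossing G.
Hypothesis loop : loopless G.

Lemma drawingP x : drawing p G x ->
  exists u v, [/\ adj G u v, (u < v)%N & segment (p u) (p v) x].
Proof.
move=> [e /= eG [u [v [E uvx]]]]; rewrite E in eG.
have := adj_neq loop eG; rewrite -val_eqE /= neq_ltn => /orP[uv|vu].
  by exists u, v.
by exists v, u; rewrite segmentC adjC.
Qed.

(** By [sides], the ends of one edge lie weakly on the same side of the line of the other. A common
    point of distinct edges then forces an end onto that line, and as no three points are collinear
    this end is a shared vertex. *)
Lemma noncrossing_plane : plane_graph p G.
Proof.
have sides u v s t : (u < v)%N -> adj G u v -> (s < t)%N -> adj G s t ->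
    0 <= orient (p u) (p v) (p s) * orient (p u) (p v) (p t).
  move=> uv uvG st stG.
  have [/andP[us tv]|o] := boolP ((u <= s) && (t <= v))%N.
    by apply: mulr_le0; apply: ccw_le0 => //; lia.
  have n1 : (u < s)%N -> (s < v)%N -> (v < t)%N -> False.
    by move=> *; exact: (nc (a:=u) (b:=v) (c:=s) (d:=t)).
  have n2 : (s < u)%N -> (u < t)%N -> (t < v)%N -> False.
    by move=> *; exact: (nc (a:=s) (b:=t) (c:=u) (d:=v)).
  apply: mulr_ge0; apply: ccw_ge0 => //.
    have [us|us] := ltnP u s; last lia.
    have [sv|sv] := ltnP s v; last lia.
    by case: (n1 us sv); lia.
  have [tv|tv] := ltnP t v; last lia.
  have [ut|ut] := ltnP u t; last lia.
  by case: (n2 _ ut tv); lia.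
move=> e f eG fG ne x [[u [v [Ee uvx]]] [s [t [Ef stx]]]].
wlog uv : u v Ee uvx / (u < v)%N.
  move=> W; rewrite Ee in eG; have := adj_neq loop eG.
  rewrite -val_eqE /= neq_ltn => /orP[uv|vu]; first exact: (W u v).
  by apply: (W v u) => //; [rewrite setUC|rewrite segmentC].
wlog st : s t Ef stx / (s < t)%N.
  move=> W; rewrite Ef in fG; have := adj_neq loop fG.
  rewrite -val_eqE /= neq_ltn => /orP[st|ts]; first exact: (W s t).
  by apply: (W t s) => //; [rewrite setUC|rewrite segmentC].
have uvG : adj G u v by rewrite /adj -Ee.
have stG : adj G s t by rewrite /adj -Ef.
have := sides u v s t uv uvG st stG.
have o0 := segment_orient0 uvx.
have uv' : u != v by rewrite -val_eqE /=; lia.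
have zero w : orient (p u) (p v) (p w) = 0 -> w = u \/ w = v.
  move=> ow; apply: contrapT => /not_orP[/eqP wu /eqP wv].
  have := @ccw_neq0 _ _ _ ccw u v w uv'.
  by rewrite ow eqxx eq_sym wv eq_sym wu => /(_ isT isT).
have inEF w : w = u \/ w = v -> w = s \/ w = t -> w \in (e :&: f)%SET.
  by move=> wuv wst; rewrite inE Ee Ef; apply/andP; split; apply/set2P.
have [r /=] := stx; rewrite in_itv /= => /andP[r0 r1] xE.
move: o0; rewrite -xE orient_conv.
set os := orient _ _ (p s); set ot := orient _ _ (p t) => o0 pos.
have [s0|s0] := eqVneq os 0.
  have [t0|t0] := eqVneq ot 0.
    case/eqP: ne; rewrite Ee Ef; move: (zero _ s0) (zero _ t0) uv st.
    by move=> [->|->] [->|->] => *; rewrite ?ltnn //; lia.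
  exists s; first by apply: inEF; [exact: zero|left].
  have -> : r = 0.
    by move/eqP: o0; rewrite s0 mulr0 add0r mulf_eq0 (negbTE t0) orbF => /eqP.
  by rewrite subr0 scale1r scale0r addr0.
have [t0|t0] := eqVneq ot 0.
  exists t; first by apply: inEF; [exact: zero|right].
  have -> : r = 1.
    move/eqP: o0; rewrite t0 mulr0 addr0 mulf_eq0 (negbTE s0) orbF subr_eq0.
    by move/eqP.
  by rewrite subrr scale1r scale0r add0r.
exfalso; have : 0 < os * ot by rewrite lt_def mulf_neq0.
case: (ltP 0 os) => [os0|]; last first.
  rewrite le_eqVlt (negbTE s0) /= => os0; rewrite nmulr_rgt0 // => ot0.
  have := @conv_gt0 _ r (- os) (- ot) r0 r1; rewrite !oppr_gt0 => /(_ os0 ot0).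
  by rewrite !mulrN -opprD o0 oppr0 ltxx.
rewrite pmulr_rgt0 // => ot0.
by have := conv_gt0 r0 r1 os0 ot0; rewrite o0 ltxx.
Qed.

Hypothesis unit : forall c d, d = c.+1 :> nat -> adj G c d.

Lemma cell_disjoint a b : (a.+1 < b)%N -> adj G a b ->
  opolygon p (cell G a b) `<=` ~` drawing p G.
Proof.
move=> ab abG x Px /drawingP[u [v [uvG uv uvx]]].
have [s sV] := edge_cell_side nc unit ab abG uvG uv.
have := Px _ sV; set t := next_in _ s => /= ox h.
have : orient (p s) (p t) x <= 0; last by lra.
by apply: segment_orient_le0 uvx _ _; apply: ccw_le0 => //; case: h => -[]; lia.
Qed.

Lemma cell_bdry_drawing a b : (a.+1 < b)%N -> adj G a b ->
  bdry p (cell G a b) `<=` drawing p G.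
Proof.
move=> ab abG x [s /= sV sx]; apply: adj_drawing sx.
exact: cell_adj.
Qed.

Lemma cell_face a b x : (a.+1 < b)%N -> adj G a b ->
  opolygon p (cell G a b) x ->
  connected_component (~` drawing p G) x = opolygon p (cell G a b).
Proof.
move=> ab abG Px; apply: opolygon_component => //.
- exact: cell_gt2.
- exact: cell_bdry_drawing.
- exact: cell_disjoint.
Qed.

Lemma cell_internal_face a b : (a.+1 < b)%N -> adj G a b ->
  internal_faces p G (opolygon p (cell G a b)).
Proof.
move=> ab abG; have c2 := cell_gt2 nc unit ab; split.
  have [x Px] := opolygon_nonempty ccw c2; exists x; last exact: cell_face.
  exact: cell_disjoint Px.
exact: opolygon_bounded.
Qed.

Lemma next_in_setT s t : t = s.+1 :> nat -> next_in [set: 'I_n]%SET s = t.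
Proof.
move=> ts; have sT : s \in [set: 'I_n]%SET by rewrite inE.
case: (next_inP sT) => [[h1 /(_ t)]|/(_ t)]; rewrite inE => /(_ isT); last lia.
by move=> h; apply/val_inj => /=; lia.
Qed.

Lemma next_in_setT_max : next_in [set: 'I_n]%SET ord_max = ord0.
Proof.
have sT : (ord_max : 'I_n) \in [set: 'I_n]%SET by rewrite inE.
case: (next_inP sT) => [[h1 _]|/(_ ord0)].
  by have := leq_ord (next_in [set: 'I_n]%SET ord_max); move: h1 => /=; lia.
by rewrite inE => /(_ isT)/andP[h _]; apply/val_inj/eqP; rewrite -leqn0.
Qed.

Hypothesis n2 : (2 < n)%N.
Hypothesis hull : adj G ord0 ord_max.

Let T2 : (2 < #|[set: 'I_n]%SET|)%N.
Proof. by rewrite cardsT card_ord. Qed.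

(* Descent: a point of the hull beyond the chord ab lies in the cell at ab or
   beyond a shorter chord of that cell. *)
Lemma cell_descent x a b : cpolygon p [set: 'I_n]%SET x -> ~ drawing p G x ->
  (a < b)%N -> adj G a b -> 0 < orient (p b) (p a) x ->
  exists c d, [/\ (c.+1 < d)%N, adj G c d & opolygon p (cell G c d) x].
Proof.
move=> hx nD; have [m] := ubnP (b - a)%N.
elim: m a b => // m IH a b bam ab abG oba.
have [E|/eqP nE] := eqVneq (b : nat) a.+1.
  have := hx a; rewrite inE (next_in_setT E) => /(_ isT).
  by rewrite orientN; lra.
have ab1 : (a.+1 < b)%N by lia.
have [Px|/existsNP[s /not_implyP[sV os]]] :=
  pselect (opolygon p (cell G a b) x).
  by exists a, b.
have os' : orient (p s) (p (next_in (cell G a b) s)) x <= 0 by rewrite leNgt;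
  apply/negP.
have sb : s != b.
  apply/eqP => E; move: os'; rewrite E cell_next_in_b //; lra.
have [st stG] := cell_next_in nc unit ab1 sV sb.
set t := next_in _ s in st stG os'.
have tV : t \in cell G a b by rewrite mem_next_in.
have := cell_bounds sV; have := cell_bounds tV => /andP[at_ tb] /andP[as_ sb'].
move: stG; rewrite adjD1 // => /andP[stG ne].
apply: (IH s t) => //; first by lia.
rewrite orientN oppr_gt0 lt_neqAle os' andbT; apply/eqP => o0; apply: nD.
apply: (adj_drawing stG).
apply: (cpolygon_chord ccw T2) => //; rewrite ?inE //.
by rewrite -val_eqE /=; lia.
Qed.

(** A point of the hull is reached by descending from the hull edge between the extreme labels. A
    point beyond a hull side lies in an open half-plane that misses the drawing, so its face is
    unbounded. *)
Lemma internal_face_cell F : internal_faces p G F ->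
  exists a b, [/\ (a.+1 < b)%N, adj G a b & F = opolygon p (cell G a b)].
Proof.
move=> [[x nD <-] bF].
have [hx|/existsNP[s /not_implyP[sV os]]] :=
  pselect (cpolygon p [set: 'I_n]%SET x).
  have om : 0 < orient (p ord_max) (p ord0) x.
    have := hx ord_max; rewrite inE next_in_setT_max => /(_ isT).
    rewrite le_eqVlt => /orP[/eqP o0|//]; exfalso; apply: nD.
    apply: (adj_drawing hull); rewrite segmentC.
    apply: (cpolygon_chord ccw T2) => //; rewrite ?inE //.
    by rewrite -val_eqE /=; lia.
  have [|c [d [cd cdG Px]]] := cell_descent hx nD _ hull om;
    first by rewrite /=; lia.
  by exists c, d; split => //; apply: cell_face.
move/negP: os; rewrite -ltNge; set t := next_in _ s => os.
case: (halfplane_unbounded os); apply: bounded_setS bF.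
apply: connected_component_max => //.
- move=> y /= oy /drawingP[u [v [uvG uv uvy]]].
  have : 0 <= orient (p s) (p t) y; last by lra.
  by apply: segment_orient_ge0 uvy _ _; apply: orient_next_in_ge0; rewrite ?inE.
- apply: convex_connected => y z /= oy oz w yzw.
  rewrite /= -oppr_gt0 -orientN; apply: segment_orient_gt0 yzw _ _;
    by rewrite orientN oppr_gt0.
Qed.

(** The polygon determines its frontier, the frontier its corners, and [a] and [b] are the least and
    greatest corner. *)
Lemma cell_opolygon_inj a b c d : (a.+1 < b)%N -> adj G a b -> (c.+1 < d)%N ->
  adj G c d ->
  opolygon p (cell G a b) = opolygon p (cell G c d) -> a = c /\ b = d.
Proof.
move=> ab abG cd cdG E.
have V2 := cell_gt2 nc unit ab; have W2 := cell_gt2 nc unit cd.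
have : bdry p (cell G a b) = bdry p (cell G c d).
  by rewrite -!frontier_opolygon // E.
move=> Eb; have sub v : (v \in cell G a b) = (v \in cell G c d).
  by apply/idP/idP => /(bdry_vertex p); [rewrite Eb|rewrite -Eb];
    apply: vertex_bdry.
have := cell_bounds (G := G) (a := c) (b := d) (s := a).
have := cell_bounds (G := G) (a := c) (b := d) (s := b).
have := cell_bounds (G := G) (a := a) (b := b) (s := c).
have := cell_bounds (G := G) (a := a) (b := b) (s := d).
rewrite -!sub cell_a // cell_b // !sub cell_a // cell_b //.
move=> /(_ isT) h1 /(_ isT) h2 /(_ isT) h3 /(_ isT) h4.
by split; apply/val_inj => /=; lia.
Qed.

(** A labelled point on a side is an end of that side, so the tracing cycle and [V] have the same
    labels: both are read off the frontier. *)
Lemma kgon_card k (V : {set 'I_n}) : (2 < #|V|)%N ->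
  kgon p k G (opolygon p V) -> #|V| = k.
Proof.
move=> V2 [c [<- uc cyc]]; rewrite frontier_opolygon // => E.
rewrite -(card_uniqP uc); apply: eq_card => v; apply/idP/idP => [vV|vc].
  have : bdry p V (p v) by exact: bdry_vertex.
  rewrite E => -[u /= uc' uv].
  have un : u != next c u by apply: (adj_neq loop); apply: next_cycle cyc uc'.
  by case: (vertex_segment ccw un uv) => ->; rewrite ?mem_next.
apply: (vertex_bdry ccw V2); rewrite E; exists v => //; exact: segment_l.
Qed.

Lemma card_kgon (V : {set 'I_n}) : (2 < #|V|)%N -> (forall s, s \in V ->
  adj G s (next_in V s)) ->
  kgon p #|V| G (opolygon p V).
Proof.
move=> V2 adjV; exists (enum V); split; rewrite -?cardE ?enum_uniq //.
  apply: cycle_from_next; first exact: enum_uniq.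
  by move=> s; rewrite mem_enum; apply: adjV.
rewrite frontier_opolygon //; apply/seteqP; split => x [s /= sV sx];
  exists s => //=.
  by rewrite mem_enum.
by rewrite -mem_enum.
Qed.

End Faces.

(** * Counting k-angulations *)

Section Kangulations.
Import mathcomp.boot.fintype mathcomp.boot.finset.
Local Open Scope nat_scope.
Variables (R : realType) (k n' : nat).
Local Notation n := n'.+1.
Variable p : 'I_n -> plane R.
Hypothesis ccw : ccw_labelled p.
Variable G : graph n.
Hypotheses (k2 : 2 < k) (n2 : 2 < n).

Lemma kangulation_dissection : kangulation p k G -> dissection k G ord_max 1.
Proof.
move=> [loop pl conn faces]; have nc := plane_noncrossing ccw pl.
have unit (c d : 'I_n) : d = c.+1 :> nat -> adj G c d.
  by move=> dc; apply: hull_edge conn _ => //; left.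
have hull : adj G ord0 ord_max.
  by rewrite adjC; apply: hull_edge conn _ => //; right.
split => //.
- move=> e eG; have /cards2P[u [v [uv E]]] := implyP (forallP loop e) eG.
  move: uv; rewrite -val_eqE /= neq_ltn => /orP[uv|vu].
    by exists u, v; split => //; exact: leq_ord.
  by exists v, u; split; rewrite ?(setUC [set v]%SET) //; exact: leq_ord.
- by move=> c d dc _; apply: unit.
- move=> a b abG ab; apply: (kgon_card ccw loop); first exact: cell_gt2.
  by apply: faces; apply: cell_internal_face.
(* The hull edge between the extreme labels hides all the others, whence [m = 1]. *)
- rewrite (_ : uncovered G ord0 ord_max = [set ord0; ord_max]%SET).
    by rewrite cards2 -val_eqE /=; case: n' n2 => // -[].
  apply/setP => v; apply/uncoveredP/set2P => [[_ _ K]|[]->]; last 2 first.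
  - by split => // c d; lia.
  - by split => // c d; have := leq_ord d; lia.
  apply: contrapT => /not_orP[/eqP v0 /eqP vm].
  move: v0 vm; rewrite -!val_eqE /= => v0 vm.
  by apply: (K ord0 ord_max) => //=; have := leq_ord v; lia.
Qed.

Lemma card_finset (T : finType) (S : {set T}) : ([set` S] #= `I_#|S|)%card.
Proof.
pose f x := index x (enum S).
have <- : (f @` [set` S] = `I_#|S|)%classic.
  apply/seteqP; split => [_ [x /= xS <-]|i /= iS].
    by rewrite /f cardE index_mem mem_enum.
  rewrite cardE in iS.
  have [x0 _] : exists x0 : T, true by case: (enum S) iS => // x0 *; exists x0.
  exists (nth x0 (enum S) i); first by rewrite /= -mem_enum mem_nth.
  by rewrite /f index_uniq // enum_uniq.
rewrite card_eq_sym; apply: inj_card_eq => x y /set_mem/= xS /set_mem/= yS E.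
rewrite -(@nth_index _ x x (enum S)) ?mem_enum // -/(f x) E.
by rewrite /f nth_index // mem_enum.
Qed.

Lemma dissection_kangulation i : n = ((k - 2) * i).+2 ->
  dissection k G ord_max 1 ->
  kangulation p k G /\ (internal_faces p G #= `I_i)%card.
Proof.
move=> ni C; have nc := dissection_nc C.
have unit (c d : 'I_n) : d = c.+1 :> nat -> adj G c d.
  by move=> dc; apply: (dissection_unit C) => //; exact: leq_ord.
have loop : loopless G.
  apply/forallP => e; apply/implyP => /(dissection_edge C)[a [b [ab _ ->]]].
  by rewrite cards2 -val_eqE /= neq_ltn ab.
have hull : adj G ord0 ord_max.
  (* Since [m = 1], the extreme labels are the only outer vertices; being consecutive there, they
     are joined. *)
  have E : uncovered G ord0 ord_max = [set ord0; ord_max]%SET.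
    apply/esym/eqP; rewrite eqEcard (dissection_out C) cards2.
    apply/andP; split; last by rewrite -val_eqE /=; case: n' n2 => // -[].
    by apply/subsetP => v /set2P[]->; [apply: uncovered_left|apply:
      uncovered_right].
  apply: (@uncovered_step _ _ ord0 ord_max) => //.
  - by move=> c d dc _ _; apply: unit.
  - by rewrite E set21.
  - by rewrite E set22.
  - by rewrite /=; lia.
  - by move=> v; rewrite E => /set2P[]->.
split.
  split => //.
  - exact: noncrossing_plane.
  - exact: hull_2connected.
  - move=> F /(internal_face_cell ccw nc loop unit n2 hull)[a [b [ab abG ->]]].
    rewrite -(dissection_cell C abG ab); apply: card_kgon => //;
      first exact: cell_gt2.
    by move=> s sV; exact: cell_adj.
have -> : internal_faces p G =
    ((fun e : 'I_n * 'I_n => opolygon p (cell G e.1 e.2)) @` [set` long_edges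
      G])%classic.
  apply/seteqP; split => F.
    move=> /(internal_face_cell ccw nc loop unit n2 hull)[a [b [ab abG ->]]].
    by exists (a, b) => //=; rewrite inE /= abG.
  by move=> [[a b] /=]; rewrite inE /= => /andP[abG ab] <-;
    apply: cell_internal_face.
(* The last label is [(k - 2) * i + 1], which leaves exactly [i] long edges when [m = 1]. *)
have <- : #|long_edges G| = i.
  have := card_long_edges k2 C; rewrite /= => E.
  by apply/eqP; rewrite -(@eqn_pmul2l (k - 2)); [apply/eqP; lia|lia].
apply: card_eq_trans (card_finset _); apply: inj_card_eq.
move=> [a b] [c d] /set_mem/=; rewrite inE /= => /andP[abG ab].
move=> /set_mem/=; rewrite inE /= => /andP[cdG cd] E.
by have [-> ->] := cell_opolygon_inj ccw nc loop unit n2 hull ab abG cd cdG E.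
Qed.

End Kangulations.

(** * Entries of the degree vectors *)

Section DegreeVector.
Import mathcomp.boot.fintype mathcomp.boot.finset.
Local Open Scope nat_scope.

Lemma degree_vectorE (R : realType) k r i
    (p : 'I_((k - 2) * i).+2 -> plane R) (j : 'I_r) :
  2 < k -> 0 < i -> ccw_labelled p ->
  degree_vector r p j ord0 = degree_count k i j.
Proof.
move=> k2 i0 ccw; rewrite mxE.
have n2 : 2 < ((k - 2) * i).+2 by rewrite !ltnS muln_gt0; lia.
set x := (ord_max : 'I_((k - 2) * i).+2).
transitivity #|[set G in dissections k x 1 | deg G x == j.+2]|.
  apply: eq_card => G; rewrite !inE.
  rewrite (_ : `[< dissection k G x 1 >] = `[< kangulation p k G /\
      (internal_faces p G #= `I_i)%card >]); last first.
    apply/asboolP/asboolP => [|[+ _]]; first exact: dissection_kangulation.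
    exact: kangulation_dissection.
  apply: andb_id2l => /asboolP[K _].
  have C := kangulation_dissection ccw k2 n2 K.
  rewrite /root_degree -/x -/(deg G x).
  (* The root degree subtracts two with truncation. The two hull edges at [x] are distinct because
     [(k - 2) * i > 0], so nothing is truncated. *)
  suff : 1 < deg G x by lia.
  have [y xy] : exists y : 'I_((k - 2) * i).+2, x = y.+1 :> nat.
    by exists (inord ((k - 2) * i)); rewrite inordK.
  case: K => _ pl conn _; have nc := plane_noncrossing ccw pl.
  have hull : adj G ord0 x by rewrite adjC; apply: hull_edge conn _ => //;
    right.
  have yx : adj G y x by apply: (dissection_unit C) => //; exact: leq_ord.
  have lt0x : (ord0 : 'I_((k - 2) * i).+2) < x by [].
  have ltyx : y < x by lia.
  have ne : [set ord0; x]%SET != [set y; x]%SET.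
    by apply/eqP => /(edge_inj lt0x ltyx)[E _]; move: xy n2; rewrite -E /=; lia.
  have c2 : #|[set [set ord0; x]; [set y; x]]%SET| = 2 by rewrite cards2 ne.
  rewrite -[X in X <= _]c2.
  by apply/subset_leq_card/subsetP => e /set2P[]->; rewrite inE set22 andbT.
rewrite /degree_count; have [ji|ij] := ltnP j i.
  (* Here [m = 1] and [d = j + 1]: the predecessor cancels [m], leaving the exponent
     [(k - 2) * (j + 1)]. *)
  rewrite (@card_dissections_deg _ k x (i - j.+1)) //=.
  by rewrite -addnA -mulnDr subnKC.
apply: card_dissections_deg_gt => //=.
by rewrite add1n ltnS ltn_pmul2l; lia.
Qed.
End DegreeVector.

Theorem theorem5 (R : realType) (k r : nat) (hk : (3 <= k)%N) (hr : (1 <= r)%N)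
  (P : forall i : nat, 'I_((k - 2) * i).+2 -> plane R)
  (hP : forall i : nat, (1 <= i <= r)%N ->
     convex_position (P i) /\ ccw_labelled (P i)) :
  production_matrix (Kmx k r) (fun i => degree_vector r (P i)).
Proof.
move=> i ir; have /andP[i1 ir1] := ir.
apply/matrixP => a b; rewrite ord1.
have [_ ccw1] : convex_position (P i.+1) /\ ccw_labelled (P i.+1) by apply: hP; lia.
have [_ ccw0] : convex_position (P i) /\ ccw_labelled (P i) by apply: hP; lia.
rewrite degree_vectorE // (@degree_count_rec k r i a) // mxE.
apply: eq_bigr => q _; rewrite degree_vectorE // mxE.
by [].
Qed.
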